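(* Let $B$ be a compact connected Riemann surface with function field $K=\mathbb{C}(B)$, let $S\subset B$ be a finite subset, let $U\subset B$ be a finite disjoint union of closed discs centered at the points of $S$, let $B_S=B\setminus U$, let $V\subset B_S$ be a finite disjoint union of closed discs, and let $B_0=B_S\setminus V$. Let $X=\mathbb{P}^1_{\mathbb{C}}\times B$ with second projection $f\colon X\to B$, and let $(0),(\infty)\subset X$ be the constant sections. Let $\tilde{Z}$ be a smooth complex algebraic variety and $Z\subset\tilde{Z}$ a compact subset with respect to the complex topology. Suppose that $\mathcal{D}\subset X\times\tilde{Z}$ is a family of effective divisors such that $\mathcal{D}\to B\times\tilde{Z}$ is flat and $\mathcal{D}_z$ is not contained in $(0)\cup(\infty)$ for every $z\in\tilde{Z}$. Let $\varepsilon>0$. Then for every $r\in\mathbb{N}$ the union $$J_{r,\varepsilon}:=\bigcup_{z\in Z}\ \bigcup_{R\subset B,\ \#(R\cap B_0)\le r}\{x\in\mathcal{O}_S^*(B_0,\varepsilon)\colon x\text{ is }(R,\mathcal{D}_z)\text{-integral in }X\}\subset\mathcal{O}_S^*$$ is finite modulo $\mathbb{C}^*$. Moreover, there exists a constant $m>0$ such that $$\#(J_{r,\varepsilon}\ \mathrm{mod}\ \mathbb{C}^* )\le m(r+1)^{2\,\mathrm{rank}\,\pi_1(B_0)}\quad\text{for every } r\in\mathbb{N}.$$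
   Context: $\mathcal{O}_S=\{x\in K\colon \mathrm{val}_\nu(x)\ge 0 \text{ for all }\nu\in B\setminus S\}$ and $\mathcal{O}_S^*$ is its group of units (the $S$-units: nonzero rational functions on $B$ with all zeros and poles in $S$). $\mathbb{C}^*\subset\mathcal{O}_S^*$ is the subgroup of nonzero constants; ''mod $\mathbb{C}^*$'' means taking the image in $\mathcal{O}_S^*/\mathbb{C}^*$. For $\varepsilon\ge 0$, $\mathcal{O}_S^*(B_0,\varepsilon):=\{x\in\mathcal{O}_S^*\colon |x(t)|>\varepsilon\text{ and }|x(t)^{-1}|>\varepsilon\ \text{for all }t\in B_0\}$. Each $x\in K$ induces a section $\sigma_x\colon B\to X$, $t\mapsto(x(t),t)$, of $f$. For an effective divisor $D\subset X$ and an arbitrary subset $R\subset B$, an element $x\in K^*$ is $(R,D)$-integral in $X$ if $f(\sigma_x(B)\cap D)\subset R$. $\mathcal{D}_z\subset X$ is the divisor of the family over $z\in\tilde Z$. Discs in Riemann surfaces are assumed to have piecewise smooth boundary. $\mathrm{rank}\,\pi_1(B_0)$ is the minimal number of generators of $\pi_1(B_0)$; $\#$ is cardinality. *)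

(* Defs.v *)
From HB Require Import structures.
From mathcomp Require Import all_boot all_order all_algebra.
From mathcomp Require Import complex.
From mathcomp Require Import all_classical all_reals all_analysis.
From mathcomp Require mpoly.

Set Implicit Arguments.
Unset Strict Implicit.
Unset Printing Implicit Defensive.

Import Order.TTheory GRing.Theory Num.Theory.
Import numFieldNormedType.Exports.

Local Open Scope classical_set_scope.
Local Open Scope ring_scope.

(* Bundling R[i] as a numClosedFieldType lets it inherit the norm topology that
   MathComp-Analysis puts on every numFieldType. *)
Definition Cx (R : realType) : numClosedFieldType := R[i].

Section RiemannSurfaces.
Variable R : realType.
Local Notation C := (Cx R).

Definition holomorphic_near (g : C -> C) (w : C) : Prop :=
  \forall z \near w, derivable g z 1.

(* f is, near p, a holomorphic function of the local coordinate phi. *)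
Definition holomorphic_via (T : topologicalType) (phi f : T -> C) (p : T) :=
  exists g : C -> C, holomorphic_near g (phi p) /\
    \forall q \near p, f q = g (phi q).

(* Connectedness is not part of the record; second countability is automatic for
   connected surfaces (Rado). *)
Record riemannSurface := RiemannSurface {
  rs_carrier :> topologicalType;
  rs_atlas : set (set rs_carrier * (rs_carrier -> C));
  rs_hausdorff : hausdorff_space rs_carrier;
  rs_cover : forall p, exists2 c, rs_atlas c & c.1 p;
  rs_chart_open : forall c, rs_atlas c -> open c.1;
  rs_chart_inj : forall c, rs_atlas c -> {in c.1 &, injective c.2};
  rs_chart_continuous : forall c, rs_atlas c -> {in c.1, continuous c.2};
  rs_chart_open_map : forall c, rs_atlas c ->
    forall W, open W -> W `<=` c.1 -> open (c.2 @` W);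
  rs_transition : forall c d, rs_atlas c -> rs_atlas d ->
    forall p, c.1 p -> d.1 p -> holomorphic_via c.2 d.2 p
}.

Variable B : riemannSurface.

Definition holomorphic_at (f : B -> C) (p : B) : Prop :=
  exists2 c, @rs_atlas B c & c.1 p /\ holomorphic_via c.2 f p.

(* The Riemann sphere: [Some z] is the point (z : 1), [None] is infinity. *)
Definition P1 := option C.
Definition P1inv (u : P1) : P1 :=
  if u is Some z then if z == 0 then None else Some z^-1 else Some 0.

(* Rational functions on a compact connected B, as holomorphic maps B -> P1
   other than the constant map infinity. *)
Definition function_field : set (B -> P1) :=
  [set x | (exists t, x t <> None) /\
    forall t, exists2 f, holomorphic_at f t &
      (\forall q \near t, x q = Some (f q)) \/
      (\forall q \near t, P1inv (x q) = Some (f q))].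

Definition Sunits (S : set B) : set (B -> P1) :=
  [set x | [/\ function_field x, exists t, x t <> Some 0 &
    forall t, x t = Some 0 \/ x t = None -> S t]].

Definition Sunits_bounded (S B0 : set B) (e : R) : set (B -> P1) :=
  [set x | Sunits S x /\ forall t, B0 t ->
    exists2 z, x t = Some z & (e%:C)%C < `|z| /\ (e%:C)%C < `|z^-1|].

Definition scale (c : C) (x : B -> P1) : B -> P1 := fun t => omap ( *%R c) (x t).

(* The image of a set of units in the quotient by the nonzero constants. *)
Definition mod_constants (J : set (B -> P1)) : set (set (B -> P1)) :=
  [set [set y | exists2 c, c != 0 & y = scale c x] | x in J].

Definition smooth (u : R -> R) : Prop :=
  forall k s, derivable (derive1n k u) s 1.

Definition piecewise_smooth (a b : R) (gamma : R -> B) : Prop :=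
  exists n (s : nat -> R), [/\ s 0%N = a, s n = b &
    forall i, (i < n)%N -> s i < s i.+1 /\
      exists2 c, @rs_atlas B c &
      exists u v : R -> R, [/\ smooth u, smooth v &
        forall h, h \in `[s i, s i.+1] ->
          [/\ c.1 (gamma h), c.2 (gamma h) = (u h +i* v h)%C &
              (derive1 u h != 0) || (derive1 v h != 0)]]].

(* A disc is a homeomorphic image of the closed unit disc; its centre is the
   image of 0, and its boundary the image of the unit circle. *)
Definition closed_disc (Delta : set B) (p : B) : Prop :=
  exists psi : C -> B,
    [/\ {within [set z | `|z| <= 1], continuous psi},
        {in [set z | `|z| <= 1] &, injective psi},
        psi @` [set z | `|z| <= 1] = Delta,
        psi 0 = p &
        piecewise_smooth 0 (pi *+ 2) (fun h => psi (cos h +i* sin h)%C)].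

Definition discs_centered_at (S U : set B) : Prop :=
  exists Delta : B -> set B,
    [/\ forall s, S s -> closed_disc (Delta s) s, trivIset S Delta &
        U = \bigcup_(s in S) Delta s].

Definition finite_disjoint_discs (V : set B) : Prop :=
  exists n (Delta : 'I_n -> set B),
    [/\ forall i, exists p, closed_disc (Delta i) p, trivIset setT Delta &
        V = \bigcup_i Delta i].

End RiemannSurfaces.

Section FundamentalGroup.
Variables (R : realType) (T : topologicalType).
Implicit Types (A : set T) (b : T) (gamma delta : R -> T).

Definition loop A b gamma : Prop :=
  [/\ {within `[0, 1], continuous gamma}, gamma 0 = b, gamma 1 = b &
      gamma @` `[0, 1] `<=` A].

Definition loop_homotopic A b gamma delta : Prop :=
  exists H : R * R -> T,
    [/\ {within `[0, 1] `*` `[0, 1], continuous H},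
        H @` (`[0, 1] `*` `[0, 1]) `<=` A,
        forall s, s \in `[0, 1] -> H (s, 0) = gamma s,
        forall s, s \in `[0, 1] -> H (s, 1) = delta s &
        forall t, t \in `[0, 1] -> H (0, t) = b /\ H (1, t) = b].

Definition loop_mul gamma delta : R -> T :=
  fun s => if s <= 2^-1 then gamma (s *+ 2) else delta (s *+ 2 - 1).
Definition loop_inv gamma : R -> T := fun s => gamma (1 - s).

(* The loop spelled by a word in the letters gamma_i, gamma_i^-1. *)
Definition loop_word b n (gamma : 'I_n -> R -> T) (w : seq ('I_n * bool)) :=
  foldr (fun l => loop_mul (if l.2 then loop_inv (gamma l.1) else gamma l.1))
    (cst b) w.

(* For A path connected, the choice of the base point b is immaterial. *)
Definition pi1_generated_by A (n : nat) : Prop :=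
  exists2 b, A b & exists2 gamma : 'I_n -> R -> T,
    forall i, loop A b (gamma i) &
    forall delta, loop A b delta ->
      exists w, loop_homotopic A b delta (loop_word b gamma w).

End FundamentalGroup.

(* The minimal number of generators of the fundamental group of A (0 by convention
   if it is not finitely generated). *)
Definition pi1_rank (R : realType) (T : topologicalType) (A : set T) : nat :=
  xget 0%N [set n | pi1_generated_by R A n /\
    forall k, pi1_generated_by R A k -> (n <= k)%N].

Section Varieties.
Variable R : realType.
Local Notation C := (Cx R).

(* A space with functions: Zariski-open sets and, for each point p, the
   complex-valued functions that are regular on a neighbourhood of p (their
   values away from p are irrelevant). *)
Record spaceWithFunctions := SpaceWithFunctions {
  swf_carrier :> Type;
  zopen : set (set swf_carrier);
  regular_at : swf_carrier -> set (swf_carrier -> C)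
}.

Definition znear (Y : spaceWithFunctions) (p : Y) (P : Y -> Prop) : Prop :=
  exists W : set Y, [/\ zopen W, W p & W `<=` P].

Definition regular_on (Y : spaceWithFunctions) (U : set Y) (f : Y -> C) : Prop :=
  forall p, U p -> regular_at p f.

Definition sum_prod (Y Y' : Type) n (g : 'I_n -> Y -> C) (h : 'I_n -> Y' -> C) :
  Y * Y' -> C := fun q => \sum_(i < n) g i q.1 * h i q.2.

(* The set Y * Y' with the structure of the categorical product: open sets and
   regular functions are locally given by sums of products g (x) h. *)
Definition product (Y Y' : spaceWithFunctions) : spaceWithFunctions :=
  @SpaceWithFunctions (Y * Y')%type
    [set W | forall p, W p -> exists (U : set Y) (U' : set Y') n g h,
      [/\ zopen U /\ zopen U', U p.1 /\ U' p.2,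
          (forall i : 'I_n, regular_on U (g i) /\ regular_on U' (h i)),
          sum_prod g h p != 0 &
          (U `*` U') `&` [set q | sum_prod g h q != 0] `<=` W]]
    (fun p => [set f | exists (U : set Y) (U' : set Y') n g h n1 g1 h1,
      [/\ zopen U /\ zopen U', U p.1 /\ U' p.2,
          (forall i : 'I_n, regular_on U (g i) /\ regular_on U' (h i)),
          (forall i : 'I_n1, regular_on U (g1 i) /\ regular_on U' (h1 i)) &
          sum_prod g1 h1 p != 0 /\
          forall q, (U `*` U') q -> sum_prod g1 h1 q != 0 ->
            f q = sum_prod g h q / sum_prod g1 h1 q]]).

Definition cofinite_open (T : Type) : set (set T) :=
  [set U | U = set0 \/ finite_set (~` U)].

(* The value of the form sum_i P_i X^i Y^(d-i) at the representative (z : 1) or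
   (1 : 0) of a point of P1; quotients of two forms of degree d do not depend on
   the representative. *)
Definition binary_form d (P : {poly C}) (u : P1 R) : C :=
  if u is Some z then \sum_(i < d.+1) P`_i * z ^+ i else P`_d.

Definition P1_space : spaceWithFunctions :=
  @SpaceWithFunctions (P1 R) (@cofinite_open (P1 R))
    (fun p => [set f | exists (d : nat) (F G : {poly C}), binary_form d G p != 0 /\
      forall q, binary_form d G q != 0 ->
        f q = binary_form d F q / binary_form d G q]).

(* A compact connected Riemann surface as a projective algebraic curve: regular
   functions are the rational functions without pole. *)
Definition curve_space (B : riemannSurface R) : spaceWithFunctions :=
  @SpaceWithFunctions B (@cofinite_open B)
    (fun p => [set f | exists2 x, function_field x &
      exists W : set B, [/\ cofinite_open W, W p &
        forall q, W q -> x q = Some (f q)]]).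

Local Notation "{ 'mpoly' n }" := (mpoly.mpoly n C).

Record affine_chart (V : spaceWithFunctions) (U : set V) n
    (phi : V -> 'I_n -> C) : Prop := AffineChart {
  chart_open : zopen U;
  chart_inj : {in U &, injective phi};
  chart_closed : exists I : set {mpoly n},
    phi @` U = [set v | forall P, I P -> mpoly.meval v P = 0];
  chart_zopen : forall W, W `<=` U -> zopen W <->
    exists I : set {mpoly n},
      W = U `&` [set p | exists2 P, I P & mpoly.meval (phi p) P != 0];
  chart_regular : forall p f, U p -> regular_at p f <->
    exists P Q : {mpoly n}, mpoly.meval (phi p) Q != 0 /\
      forall q, U q -> mpoly.meval (phi q) Q != 0 ->
        f q = mpoly.meval (phi q) P / mpoly.meval (phi q) Q
}.

Record variety (V : spaceWithFunctions) : Prop := Variety {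
  variety_openT : zopen [set: V];
  variety_openI : forall U W : set V, zopen U -> zopen W -> zopen (U `&` W);
  variety_open_bigcup : forall F : set (set V), F `<=` @zopen V ->
    zopen (\bigcup_(W in F) W);
  variety_cover : exists (k : nat) (U : 'I_k -> set V),
    (forall i, exists n (phi : V -> 'I_n -> C), affine_chart (U i) phi) /\
    forall p, exists i, U i p;
  variety_separated : @zopen (product V V) [set p | p.1 <> p.2]
}.

(* Near p, V is embedded in affine n-space with ideal generated at p by c
   polynomials whose differentials at p are linearly independent. Polynomial identities are written
   as identities of functions on C^n. *)
Definition smooth_at (V : spaceWithFunctions) (p : V) : Prop :=
  exists (U : set V) n (phi : V -> 'I_n -> C) c (g : 'I_c -> {mpoly n}),
    [/\ affine_chart U phi, U p,
        forall k q, U q -> mpoly.meval (phi q) (g k) = 0,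
        forall P : {mpoly n}, (forall q, U q -> mpoly.meval (phi q) P = 0) ->
          exists (Q : {mpoly n}) (a : 'I_c -> {mpoly n}),
            mpoly.meval (phi p) Q != 0 /\
            forall v, mpoly.meval v Q * mpoly.meval v P =
              \sum_(k < c) mpoly.meval v (a k) * mpoly.meval v (g k) &
        \rank (\matrix_(k < c, j < n)
          mpoly.meval (phi p) (mpoly.mderiv j (g k))) = c].

(* Varieties are reduced and separated, not necessarily irreducible. *)
Definition smooth_variety (V : spaceWithFunctions) : Prop :=
  variety V /\ forall p : V, smooth_at p.

(* V with its complex topology, the coarsest one in which Zariski-open sets are
   open and regular functions on them are continuous. *)
Definition analytic (V : spaceWithFunctions) : Type := V.

Definition analytic_subbase (V : spaceWithFunctions) : set (set (analytic V)) :=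
  [set W | exists (U : set V) f (N : set C),
    [/\ zopen U, regular_on U f, open N & W = U `&` f @^-1` N]].

HB.instance Definition _ V := gen_eqMixin (analytic V).
HB.instance Definition _ V := gen_choiceMixin (analytic V).
HB.instance Definition _ V :=
  @isSubBaseTopological.Build (analytic V) (set (analytic V))
    (@analytic_subbase V) id.

End Varieties.

Section Flatness.

Definition balanced (A : comNzRingType) (N M : lmodType A) (G : zmodType)
    (beta : N -> M -> G) : Prop :=
  [/\ forall n n' m, beta (n + n') m = beta n m + beta n' m,
      forall n m m', beta n (m + m') = beta n m + beta n m' &
      forall a n m, beta (a *: n) m = beta n (a *: m)].

(* The element of the tensor product of N and M that is the sum of the pure
   tensors n (x) m over (n, m) in s is zero, by the universal property. *)
Definition tensor_eq0 (A : comNzRingType) (N M : lmodType A)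
    (s : seq (N * M)) : Prop :=
  forall (G : zmodType) (beta : N -> M -> G), balanced beta ->
    \sum_(nm <- s) beta nm.1 nm.2 = 0.

(* Tensoring with M preserves injectivity of linear maps. *)
Definition flat_module (A : comNzRingType) (M : lmodType A) : Prop :=
  forall (N N' : lmodType A) (u : {linear N -> N'}), injective u ->
    forall s : seq (N * M),
      tensor_eq0 [seq (u nm.1, nm.2) | nm <- s] -> tensor_eq0 s.

End Flatness.

Section Divisors.
Variable R : realType.
Local Notation C := (Cx R).

(* A closed subscheme, as the family of stalks of its ideal sheaf. *)
Definition subscheme (Y : spaceWithFunctions R) : Type := Y -> set (Y -> C).

Definition non_zero_divisor_at (Y : spaceWithFunctions R) (q : Y) (f : Y -> C) :=
  forall h, regular_at q h -> znear q (fun y => f y * h y = 0) ->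
    znear q (fun y => h y = 0).

(* An effective Cartier divisor: the ideal is locally generated by one non zero
   divisor. *)
Definition effective_divisor (Y : spaceWithFunctions R) (D : subscheme Y) : Prop :=
  forall p, exists (U : set Y) f, [/\ zopen U, U p, regular_on U f &
    forall q, U q -> non_zero_divisor_at q f /\
      D q = [set g | regular_at q g /\ exists2 h, regular_at q h &
               znear q (fun y => g y = f y * h y)]].

Definition supp (Y : spaceWithFunctions R) (D : subscheme Y) : set Y :=
  [set p | forall g, D p g -> g p = 0].

(* germ presents A as the local ring of Y at p. *)
Record is_local_ring (Y : spaceWithFunctions R) (p : Y) (A : comNzRingType)
    (germ : (Y -> C) -> A) : Prop := IsLocalRing {
  local_ring1 : germ (cst 1) = 1;
  local_ringD : forall f g, regular_at p f -> regular_at p g ->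
    germ (fun y => f y + g y) = germ f + germ g;
  local_ringM : forall f g, regular_at p f -> regular_at p g ->
    germ (fun y => f y * g y) = germ f * germ g;
  local_ring_surj : forall a, exists2 f, regular_at p f & germ f = a;
  local_ring_eq0 : forall f, regular_at p f ->
    germ f = 0 <-> znear p (fun y => f y = 0)
}.

(* res presents M as the local ring of D at p, a module over the local ring A
   of Y' at pr p through the morphism pr : Y -> Y'. *)
Record is_local_module (Y Y' : spaceWithFunctions R) (pr : Y -> Y')
    (D : subscheme Y) (p : Y) (A : comNzRingType) (germ : (Y' -> C) -> A)
    (M : lmodType A) (res : (Y -> C) -> M) : Prop := IsLocalModule {
  local_moduleD : forall f g, regular_at p f -> regular_at p g ->
    res (fun y => f y + g y) = res f + res g;
  local_moduleZ : forall a f, regular_at (pr p) a -> regular_at p f ->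
    res (fun y => a (pr y) * f y) = germ a *: res f;
  local_module_surj : forall m, exists2 f, regular_at p f & res f = m;
  local_module_eq0 : forall f, regular_at p f -> res f = 0 <-> D p f
}.

(* The morphism D -> Y' induced by pr is flat at every (closed) point of D. *)
Definition flat_along (Y Y' : spaceWithFunctions R) (pr : Y -> Y')
    (D : subscheme Y) : Prop :=
  forall p, supp D p ->
    exists (A : comNzRingType) (germ : (Y' -> C) -> A)
      (M : lmodType A) (res : (Y -> C) -> M),
      [/\ is_local_ring (pr p) germ, is_local_module pr D p germ res &
          flat_module M].

(* A family of effective divisors on Y parametrized by Z: a relative effective
   Cartier divisor on the product over Z. *)
Definition divisor_family (Y Z : spaceWithFunctions R)
    (D : subscheme (product Y Z)) : Prop :=
  effective_divisor D /\ @flat_along (product Y Z) Z snd D.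

(* The support of the divisor D_z. *)
Definition fiber (Y Z : spaceWithFunctions R) (D : subscheme (product Y Z))
  (z : Z) : set Y := [set y | supp D (y, z)].

Variable B : riemannSurface R.

Definition ruled : spaceWithFunctions R := product (P1_space R) (curve_space B).

Definition constant_section (a : P1 R) : set ruled := [set y | y.1 = a].

Definition induced_section (x : B -> P1 R) : B -> ruled := fun t => (x t, t).

Definition integral_rel (T : set B) (E : set ruled) (x : B -> P1 R) : Prop :=
  snd @` (range (induced_section x) `&` E) `<=` T.

Definition drop_P1 (Z : spaceWithFunctions R)
    (y : product ruled Z) : product (curve_space B) Z := (y.1.2, y.2).

Definition large_union (S B0 : set B) (Zt : spaceWithFunctions R)
    (Z : set Zt) (D : subscheme (product ruled Zt)) (r : nat) (e : R) :
    set (B -> P1 R) :=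
  \bigcup_(z in Z) \bigcup_(T in [set T : set B | (T `&` B0 #<= `I_r)%card])
    [set x | Sunits_bounded S B0 e x /\ integral_rel T (fiber D z) x].

End Divisors.

(* Main.v *)
Require Import Defs.
From HB Require Import structures.
From mathcomp Require Import all_boot all_order all_algebra.
From mathcomp Require Import complex finmap ring lra zify.
From mathcomp Require Import all_classical all_reals all_analysis.

Set Implicit Arguments.
Unset Strict Implicit.
Unset Printing Implicit Defensive.

Import Order.TTheory GRing.Theory Num.Theory.
Import numFieldNormedType.Exports.

Local Open Scope classical_set_scope.
Local Open Scope ring_scope.

(** Since e > 0, the whole set O_S^*(B_0, e) is already finite modulo constants,
    so the integrality condition only removes classes and m can be taken
    independent of r. An S-unit is determined up to a constant by its vector of
    orders on S. The functions log |x| are real-linear in that vector up to an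
    additive constant (maximum principle on the compact surface B), and they are
    linearly independent modulo constants on every nonempty open subset of B
    (isolated zeros of the residue-like function K + z sum a_j h_j'/h_j in a
    coordinate z). As |log |x|| <= - ln e on B_0, the order vectors are bounded.
    If B_0 is empty, then B is one closed disc, S has at most one point, and all
    S-units are constant.

    The complex analysis is integral-free: Goursat's bisection is run directly on
    dyadic Riemann sums over squares, whose common sides cancel exactly. *)

(** The coefficients of a relation between order vectors are real, so a combination of the log |x_j|
    need not be the logarithm of the modulus of a meromorphic function; this forces the use of
    harmonic functions. They are carried as a real function u with a holomorphic F such that du =
    Re(F dz): no second derivative and no conjugate function occurs, and one factorization lemma for
    holomorphic functions serves both for the maximum principle and for the isolation of critical
    points. The bound on order vectors is then linear algebra: finitely many points of B_0 separate
    the logarithms of a basis of units, and a fixed matrix recovers the coefficients of any unit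
    from its logarithms there. The estimate |h(0)| <= 2 M, with M a bound for |h| on an annulus,
    replaces Cauchy's formula. It is 4 |h(0)| <= 8 M, where 4 stands for 2 pi and 8 s is the
    perimeter of a square of half-side s. The factor 2 does not depend on h, hence is harmless when
    zeros of arbitrarily high order are divided out. *)

Section ComplexNorm.
Variable R : realType.
Local Notation C := (Cx R).
Implicit Types (z w h : C).

Definition nm (z : C) : R := Normc.normc z.

Lemma normE z : `|z| = (nm z)%:C%C. Proof. by []. Qed.

Lemma nmM z w : nm (z * w) = nm z * nm w. Proof. exact: Normc.normcM. Qed.

Lemma nmV z : nm z^-1 = (nm z)^-1. Proof. exact: Normc.normcV. Qed.

Lemma nmD z w : nm (z + w) <= nm z + nm w. Proof. exact: le_normcD. Qed.

Lemma nmD_le z w (a b : R) : nm z <= a -> nm w <= b -> nm (z + w) <= a + b.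
Proof. by move=> za wb; rewrite (le_trans (nmD _ _))// lerD. Qed.

Lemma nmN z : nm (- z) = nm z. Proof. exact: normcN. Qed.

Lemma nmBC z w : nm (z - w) = nm (w - z). Proof. by rewrite -nmN opprB. Qed.

Lemma nm_ge0 z : 0 <= nm z. Proof. by have := normr_ge0 z; rewrite normE ler0c. Qed.

Lemma nm0 : nm 0 = 0. Proof. exact: Normc.normc0. Qed.

Lemma nm1 : nm 1 = 1. Proof. exact: Normc.normc1. Qed.

Lemma nmX z n : nm (z ^+ n) = nm z ^+ n.
Proof. by elim: n => [|n IH]; rewrite ?expr0 ?nm1 // !exprS nmM IH. Qed.

Lemma nm_eq0 z : (nm z == 0) = (z == 0).
Proof. by apply/eqP/eqP => [/Normc.eq0_normc|->]; rewrite ?nm0. Qed.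

Lemma nm_gt0 z : (0 < nm z) = (z != 0).
Proof. by rewrite lt_def nm_eq0 nm_ge0 andbT. Qed.

Lemma nmB z w : nm (z - w) <= nm z + nm w.
Proof. by rewrite -(nmN w) nmD. Qed.

Lemma nm_sub x z w : nm (x - w) <= nm (x - z) + nm (z - w).
Proof. by have := nmD (x - z) (z - w); rewrite addrA subrK. Qed.

Lemma nm_real (a : R) : nm a%:C%C = `|a|.
Proof. by rewrite /nm /= expr0n addr0 sqrtr_sqr. Qed.

Lemma nm_Re z : `|complex.Re z| <= nm z.
Proof. by have := normc_ge_Re z; rewrite normE lecR. Qed.

Lemma nm_Im z : `|complex.Im z| <= nm z.
Proof.
have := nm_Re (z * 'i%C); rewrite ReiNIm nmM normrN.
by rewrite /nm /= expr0n expr1n add0r sqrtr1 mulr1.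
Qed.

Lemma nm_le_ReIm z : nm z <= `|complex.Re z| + `|complex.Im z|.
Proof.
rewrite {1}(complexE z) (le_trans (nmD _ _))// nmM !nm_real.
by rewrite /nm /= expr0n expr1n add0r sqrtr1 mul1r.
Qed.

(** Balls of the numeric field [C] have radii in [C] itself; a positive radius is real there, so
    real radii describe the same neighbourhoods. *)
Lemma nbhs_nmP w (P : set C) :
  nbhs w P <-> exists2 d : R, 0 < d & forall z, nm (z - w) < d -> P z.
Proof.
split=> [/nbhs_ballP[e /= e0 eP]|[d d0 dP]].
  have er : e \is Num.real by exact: gtr0_real.
  have e0' : 0 < complex.Re e by rewrite -(ltcR 0) (RRe_real er).
  exists (complex.Re e) => // z zw; apply: eP; rewrite /ball /= normE nmBC.
  by rewrite -(RRe_real er) ltcR.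
apply/nbhs_ballP; exists d%:C%C; first by rewrite /= (ltcR 0).
by move=> z; rewrite /ball /= normE ltcR nmBC => /dP.
Qed.

(** Differentiability without division and with real constants: the estimate also holds at [w = z],
    so it can be summed over the sides of a square. *)
Definition cdiff (f : C -> C) (z d : C) : Prop := forall e : R, 0 < e ->
  exists2 r : R, 0 < r & forall w, nm (w - z) < r ->
    nm (f w - f z - d * (w - z)) <= e * nm (w - z).

Lemma is_derive_cdiff f z d : is_derive z 1 f d -> cdiff f z d.
Proof.
move=> [fz fd] e e0; have /= := fz; rewrite /derivable => /cvg_ex[l fl].
have El : l = d by rewrite -fd /derive; apply/esym/cvg_lim.
move: fl => /cvgrPdist_lt /(_ e%:C%C); rewrite (ltcR 0) => /(_ e0).
move=> /nbhs_ballP[r /= r0 rP].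
have [r' r'0 r'P] : exists2 r' : R, 0 < r' & forall h, nm h < r' -> h != 0 ->
    nm (d - h^-1 * (f (h + z) - f z)) < e.
  have rr : r \is Num.real by exact: gtr0_real.
  exists (complex.Re r); first by rewrite -(ltcR 0) (RRe_real rr).
  move=> h hr h0; have := rP h; rewrite /ball /= sub0r normrN normE.
  rewrite -(RRe_real rr) ltcR => /(_ hr h0).
  by rewrite El normE ltcR /GRing.scale /= mulr1.
exists r' => // w wr; have [->|wz] := eqVneq w z.
  by rewrite !subrr mulr0 subr0 nm0 mulr0.
have h0 : w - z != 0 by rewrite subr_eq0.
have := r'P _ wr h0; rewrite subrK => H.
have -> : f w - f z - d * (w - z) =
    - ((w - z) * (d - (w - z)^-1 * (f w - f z))).
  by rewrite (mulrBr _ d) mulVKf// opprB (mulrC d).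
by rewrite nmN nmM mulrC ler_wpM2r ?nm_ge0// ltW.
Qed.

Lemma cdiff_is_derive f z d : cdiff f z d -> is_derive z 1 f d.
Proof.
move=> fd.
have fl : (fun h : C => h^-1 *: ((f \o shift z) (h *: 1) - f z)) @ 0^' --> d.
  apply/cvgrPdist_le => e e0.
  have er : e \is Num.real by exact: gtr0_real.
  have e0' : 0 < complex.Re e by rewrite -(ltcR 0) (RRe_real er).
  have [r r0 rP] := fd _ e0'.
  apply/nbhs_ballP; exists r%:C%C; first by rewrite /= (ltcR 0).
  move=> h; rewrite /ball /= sub0r normrN normE ltcR => hr h0.
  have := rP (h + z); rewrite addrK => /(_ hr) H.
  rewrite -(RRe_real er) normE lecR /GRing.scale /= mulr1.
  have -> : d - h^-1 * (f (h + z) - f z) =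
    - (h^-1 * (f (h + z) - f z - d * h)).
    by rewrite (mulrBr _ _ (d * h)) opprB (mulrCA _ d) mulVf// mulr1.
  by rewrite nmN nmM nmV mulrC ler_pdivrMr// nm_gt0.
split; first by apply/cvg_ex; exists d.
exact: cvg_lim.
Qed.

Lemma cdiff_cont f z d : cdiff f z d -> forall e : R, 0 < e ->
  exists2 r : R, 0 < r & forall w, nm (w - z) < r -> nm (f w - f z) < e.
Proof.
move=> fd e e0; have [r r0 rP] := fd 1 ltr01.
have d1 : 0 < nm d + 1 by rewrite ltr_wpDl ?nm_ge0.
exists (Num.min r (e / (nm d + 1))); first by rewrite lt_min r0 divr_gt0.
move=> w; rewrite lt_min => /andP[/rP wr wd].
have := nmD (f w - f z - d * (w - z)) (d * (w - z)); rewrite subrK nmM => H.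
apply: le_lt_trans H _; move: wd; rewrite ltr_pdivlMr// => wd.
nra.
Qed.

Lemma dD (f g : C -> C) z : derivable f z 1 -> derivable g z 1 ->
  derivable (fun w : C => f w + g w : C) z 1.
Proof. exact: (@derivableD C C C f g z 1). Qed.

Lemma dB (f g : C -> C) z : derivable f z 1 -> derivable g z 1 ->
  derivable (fun w : C => f w - g w : C) z 1.
Proof. exact: (@derivableB C C C f g z 1). Qed.

Lemma dM (f g : C -> C) z : derivable f z 1 -> derivable g z 1 ->
  derivable (fun w : C => f w * g w : C) z 1.
Proof. exact: (@derivableM C C f g z 1). Qed.

Lemma dV (f : C -> C) z : derivable f z 1 -> f z != 0 ->
  derivable (fun w : C => (f w)^-1 : C) z 1.
Proof. by move=> fz f0; exact: (@derivableV C C f z 1 f0 fz). Qed.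

Lemma d_cst (a : C) z : derivable (fun _ : C => a) z 1.
Proof. exact: derivable_cst. Qed.

Lemma d_id z : derivable (fun w : C => w) z 1.
Proof. exact: derivable_id. Qed.

End ComplexNorm.
Arguments d_id {R} z.
Arguments d_cst {R} a z.

(** * Goursat's theorem for dyadic sums over squares *)

Section Goursat.
Variable R : realType.
Local Notation C := (Cx R).
Local Notation I := ('i%C : C).
Implicit Types (f g : C -> C) (a p d z : C) (s : R).

(* Dyadic left Riemann sum of f over the segment from p to p + d. *)
Fixpoint rsum (n : nat) (f : C -> C) (p d : C) : C :=
  if n is n'.+1 then rsum n' f p (d / 2) + rsum n' f (p + d / 2) (d / 2)
  else d * f p.

Lemma rsumD n f g p d :
  rsum n (fun z => f z + g z) p d = rsum n f p d + rsum n g p d.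
Proof.
elim: n p d => [|n IH] p d /=; first by rewrite mulrDr.
by rewrite !IH addrACA.
Qed.

Lemma rsum_eq n f g p d : f =1 g -> rsum n f p d = rsum n g p d.
Proof. by move=> fg; elim: n p d => [|n IH] p d /=; rewrite ?fg ?IH. Qed.

(** The left sum of the identity over [0, 1], that is (1 - 2^-n) / 2. *)
Definition half_sum (n : nat) : C :=
  iter n (fun c : C => 4^-1 + c / 2) 0.

Lemma rsum_affine n (u v : C) p d :
  rsum n (fun z => u + v * z) p d = d * u + v * (d * p + d ^+ 2 * half_sum n).
Proof.
elim: n p d => [|n IH] p d; rewrite /half_sum /=; first by ring.
rewrite !IH -/(half_sum n); field; exact: isT.
Qed.

Lemma nm_half (d : C) : nm (d / 2) = nm d / 2.
Proof.
rewrite nmM nmV; congr (_ / _).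
by have := @nm_real R 2; rewrite rmorph_nat => ->; rewrite ger0_norm.
Qed.

Lemma rsum_le n f p d M :
  (forall t : R, 0 <= t <= 1 -> nm (f (p + t%:C%C * d)) <= M) ->
  nm (rsum n f p d) <= nm d * M.
Proof.
have h2 : (2^-1 : R)%:C%C = 2^-1 :> C by rewrite fmorphV rmorph_nat.
elim: n p d => [|n IH] p d fM /=.
  rewrite nmM ler_wpM2l ?nm_ge0//.
  by have := fM 0; rewrite lexx ler01 mul0r addr0 => /(_ isT).
apply: le_trans (nmD _ _) _.
have -> : nm d * M = nm (d / 2) * M + nm (d / 2) * M by rewrite nm_half; field.
apply: lerD; apply: IH => t /andP[t0 t1].
  have := fM (t / 2); rewrite rmorphM /= h2 -mulrA [_ * d]mulrC; apply.
  by apply/andP; split; lra.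
have -> : p + d / 2 + t%:C%C * (d / 2) = p + (2^-1 + t / 2)%:C%C * d.
  by rewrite rmorphD rmorphM /= h2; ring.
by apply: fM; apply/andP; split; lra.
Qed.

(* Riemann sum of f dz over the boundary of the square with corners a, a + s,
   a + s + i s, a + i s; opposite sides are sampled in the same direction, so
   that common sides of adjacent squares cancel exactly. *)
Definition sqsum n f a d : C :=
  rsum n f a d + rsum n f (a + d) (I * d) - rsum n f (a + I * d) d
  - rsum n f a (I * d).

Lemma sqsumD n f g a d :
  sqsum n (fun z => f z + g z) a d = sqsum n f a d + sqsum n g a d.
Proof. by rewrite /sqsum !rsumD; ring. Qed.

Lemma sqsum_eq n f g a d : f =1 g -> sqsum n f a d = sqsum n g a d.
Proof. by move=> fg; rewrite /sqsum !(rsum_eq _ _ _ fg). Qed.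

(** Opposite sides are sampled with the same displacement, hence have the same discretization error
    [v * d ^+ 2 * half_sum n]. The sum thus vanishes exactly at every level, and a tangent can be
    subtracted without passing to the limit. *)
Lemma sqsum_affine n (u v : C) a d : sqsum n (fun z => u + v * z) a d = 0.
Proof.
rewrite /sqsum !rsum_affine.
have I2 : I ^+ 2 = -1 := sqr_i R.
by rewrite !exprMn I2; ring.
Qed.

Lemma sqsumS n f a d : sqsum n.+1 f a d =
  sqsum n f a (d / 2) + sqsum n f (a + d / 2) (d / 2) +
  sqsum n f (a + I * (d / 2)) (d / 2) +
  sqsum n f (a + d / 2 + I * (d / 2)) (d / 2).
Proof.
rewrite /sqsum /= -!(mulrA I d 2^-1).
have -> : a + d + I * (d / 2) = a + d / 2 + I * (d / 2) + d / 2 by field.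
have -> : a + I * d = a + I * (d / 2) + I * (d / 2) by field.
have -> : a + d = a + d / 2 + d / 2 by field.
have -> : a + I * (d / 2) + I * (d / 2) + d / 2 =
  a + d / 2 + I * (d / 2) + I * (d / 2) by ring.
have -> : a + I * (d / 2) + d / 2 = a + d / 2 + I * (d / 2) by ring.
by ring.
Qed.

Definition in_square a s z :=
  (complex.Re a <= complex.Re z <= complex.Re a + s) &&
  (complex.Im a <= complex.Im z <= complex.Im a + s).

Lemma nmI : nm I = 1.
Proof. by rewrite /nm /= expr0n expr1n add0r sqrtr1. Qed.

Lemma in_squareE a s (x y : R) :
  in_square a s (a + (x +i* y)%C) = (0 <= x <= s) && (0 <= y <= s).
Proof.
case: a => a b; rewrite /in_square /=.
by rewrite !lerDl !lerD2l.
Qed.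

Definition on_sides a s z :=
  [|| complex.Re z == complex.Re a, complex.Re z == complex.Re a + s,
      complex.Im z == complex.Im a | complex.Im z == complex.Im a + s].

Lemma on_sidesE a s (x y : R) :
  on_sides a s (a + (x +i* y)%C) = [|| x == 0, x == s, y == 0 | y == s].
Proof.
case: a => a b; rewrite /on_sides /=.
have E (u v : R) : (u + v == u) = (v == 0) by rewrite -subr_eq0 addrAC subrr add0r.
by rewrite !E !(inj_eq (addrI _)).
Qed.

Lemma sideE (t s : R) : [/\ t%:C%C * s%:C%C = (t * s +i* 0)%C :> C,
  t%:C%C * (I * s%:C%C) = (0 +i* (t * s))%C :> C,
  s%:C%C + t%:C%C * (I * s%:C%C) = (s +i* (t * s))%C :> C &
  I * s%:C%C + t%:C%C * s%:C%C = (t * s +i* s)%C :> C].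
Proof.
by split; apply/eqP; rewrite eq_complex /=; apply/andP; split; apply/eqP; ring.
Qed.

Lemma sqsum_le n f a s M : 0 <= s ->
  (forall z, in_square a s z -> on_sides a s z -> nm (f z) <= M) ->
  nm (sqsum n f a s%:C%C) <= 4 * s * M.
Proof.
move=> s0 fM.
have ts (t : R) : 0 <= t <= 1 -> 0 <= t * s <= s.
  by move=> /andP[t0 t1]; rewrite mulr_ge0// ler_piMl.
have b1 := @rsum_le n f a s%:C%C M.
have b2 := @rsum_le n f (a + s%:C%C) (I * s%:C%C) M.
have b3 := @rsum_le n f (a + I * s%:C%C) s%:C%C M.
have b4 := @rsum_le n f a (I * s%:C%C) M.
move: b1 b2 b3 b4; rewrite !nmM nmI mul1r !nm_real (ger0_norm s0).
move=> /(_ _)/wrap[|b1].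
  move=> t /ts tsP; have [-> _ _ _] := sideE t s.
  by apply: fM; rewrite ?in_squareE ?on_sidesE ?tsP ?lexx ?s0 ?eqxx ?orbT.
move=> /(_ _)/wrap[|b2].
  move=> t /ts tsP; rewrite -addrA; have [_ _ -> _] := sideE t s.
  by apply: fM; rewrite ?in_squareE ?on_sidesE ?tsP ?lexx ?s0 ?eqxx ?orbT.
move=> /(_ _)/wrap[|b3].
  move=> t /ts tsP; rewrite -addrA; have [_ _ _ ->] := sideE t s.
  by apply: fM; rewrite ?in_squareE ?on_sidesE ?tsP ?lexx ?s0 ?eqxx ?orbT.
move=> /(_ _)/wrap[|b4].
  move=> t /ts tsP; have [_ -> _ _] := sideE t s.
  by apply: fM; rewrite ?in_squareE ?on_sidesE ?tsP ?lexx ?s0 ?eqxx ?orbT.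
rewrite /sqsum; apply: le_trans (nmB _ _) _.
apply: le_trans (lerD (nmB _ _) (lexx _)) _.
apply: le_trans (lerD (lerD (nmD _ _) (lexx _)) (lexx _)) _.
by lra.
Qed.

Lemma small_dyadic s (r : R) : 0 < s -> 0 < r -> exists k : nat, s / 2 ^+ k < r.
Proof.
move=> s0 r0.
have /cvgrPdist_lt/(_ (r / s)) : (fun n => 2^-1 ^+ n : R) @ \oo --> 0.
  by apply: cvg_expr; rewrite ger0_norm; lra.
move=> /(_ (divr_gt0 r0 s0))[k _ /(_ k (leqnn k))] /=.
rewrite sub0r normrN ger0_norm ?exprn_ge0// exprVn ltr_pdivlMr// mulrC => H.
by exists k.
Qed.

Lemma nested_intervals (u l : nat -> R) :
  (forall k, u k <= u k.+1) -> (forall k, u k.+1 + l k.+1 <= u k + l k) ->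
  (forall k, 0 <= l k) -> exists q : R, forall k, u k <= q <= u k + l k.
Proof.
move=> uS ulS l0.
have um k j : (k <= j)%N -> u k <= u j.
  by move=> /subnK <-; elim: (j - k)%N => // n IH; apply: le_trans IH (uS _).
have ulm k j : (k <= j)%N -> u j + l j <= u k + l k.
  by move=> /subnK <-; elim: (j - k)%N => // n IH; apply: le_trans (ulS _) IH.
have ub k j : u j <= u k + l k.
  have [jk|/ltnW kj] := leqP j k.
    by rewrite (le_trans (um _ _ jk))// lerDl.
  by rewrite (le_trans _ (ulm _ _ kj))// lerDl.
have ubP k : ubound (range u) (u k + l k) by move=> _ [j _ <-].
exists (sup (range u)) => k; apply/andP; split.
  by apply: sup_upper_bound; [split; [exists (u 0%N), 0%N|exists (u 0%N + l 0%N)]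
    |exists k].
by apply: ge_sup; [exists (u 0%N), 0%N|exact: ubP].
Qed.

Section BadSquares.
Variables (f : C -> C) (e : R).

(** The threshold is proportional to the area, so that it is inherited by one of the four
    quarters. *)
Definition bad a s := forall N, exists2 n, (N <= n)%N &
  e * s ^+ 2 < nm (sqsum n f a s%:C%C).

Lemma not_bad a s : ~ bad a s -> exists N, forall n, (N <= n)%N ->
  nm (sqsum n f a s%:C%C) <= e * s ^+ 2.
Proof.
move=> /existsNP[N HN]; exists N => n Nn; rewrite leNgt; apply/negP => H.
by apply: HN; exists n.
Qed.

Lemma bad_quarter a s : bad a s -> exists b, [/\ bad b (s / 2),
  complex.Re a <= complex.Re b <= complex.Re a + s / 2 &
  complex.Im a <= complex.Im b <= complex.Im a + s / 2] \/ s < 0.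
Proof.
move=> bad_a; have [s0|s0] := ltP s 0; first by exists a; right.
have h2 : (s / 2)%:C%C = s%:C%C / 2 :> C by rewrite rmorphM /= fmorphV rmorph_nat.
set h := s%:C%C / 2 : C.
have Ih : I * h = (0 +i* (s / 2))%C :> C.
  by rewrite /h -h2; apply/eqP; rewrite eq_complex /=; apply/andP; split; apply/eqP; ring.
have hE : h = (s / 2 +i* 0)%C :> C by rewrite /h -h2.
have s20 : 0 <= s / 2 by lra.
suff [b [b1 b2]] : exists b, bad b (s / 2) /\
    (b = a \/ b = a + h \/ b = a + I * h \/ b = a + h + I * h).
  exists b; left; split => //.
    by move: b2 => [->|[->|[->|->]]]; rewrite ?Ih ?hE; case: (a) => ? ? /=;
       apply/andP; split; lra.
  by move: b2 => [->|[->|[->|->]]]; rewrite ?Ih ?hE; case: (a) => ? ? /=;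
       apply/andP; split; lra.
have [?|/not_bad[N1 P1]] := pselect (bad a (s / 2)); first by exists a; split; tauto.
have [?|/not_bad[N2 P2]] := pselect (bad (a + h) (s / 2)).
  by exists (a + h); split; tauto.
have [?|/not_bad[N3 P3]] := pselect (bad (a + I * h) (s / 2)).
  by exists (a + I * h); split; tauto.
have [?|/not_bad[N4 P4]] := pselect (bad (a + h + I * h) (s / 2)).
  by exists (a + h + I * h); split; tauto.
(* The successor makes the level positive: a subdivision lowers it by one, and the quarters must
   still be beyond their own thresholds. *)
have [n] := bad_a (maxn N1 (maxn N2 (maxn N3 N4))).+1.
case: n => // n; rewrite ltnS !geq_max => /and4P[n1 n2 n3 n4].
rewrite sqsumS ltNge => /negP; case.
have {P1}P1 := P1 _ n1; have {P2}P2 := P2 _ n2.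
have {P3}P3 := P3 _ n3; have {P4}P4 := P4 _ n4.
rewrite h2 -/h in P1 P2 P3 P4 *.
apply: le_trans (nmD _ _) _.
apply: le_trans (lerD (nmD _ _) (lexx _)) _.
apply: le_trans (lerD (lerD (nmD _ _) (lexx _)) (lexx _)) _.
have E : (s / 2) ^+ 2 = s ^+ 2 / 4 by field.
rewrite E in P1 P2 P3 P4; lra.
Qed.

End BadSquares.

Lemma goursat f a s : 0 < s ->
  (forall z, in_square a s z -> exists d, cdiff f z d) ->
  forall e, 0 < e -> exists N, forall n, (N <= n)%N ->
    nm (sqsum n f a s%:C%C) <= e.
Proof.
move=> s0 fd e e0.
have es0 : 0 < e / s ^+ 2 by rewrite divr_gt0// exprn_gt0.
suff : ~ bad f (e / s ^+ 2) a s.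
  by move=> /not_bad[N NP]; exists N => n /NP; rewrite divfK// lt0r_neq0// exprn_gt0.
move: (e / s ^+ 2) es0 => {e0}e e0 bad_a.
pose len k : R := s / 2 ^+ k.
have len_gt0 k : 0 < len k by rewrite divr_gt0// exprn_gt0.
have lenS k : len k.+1 = len k / 2.
  by rewrite /len exprS invfM [_^-1 * _]mulrC mulrA.
have step (ak : C * nat) : exists b, bad f e ak.1 (len ak.2) ->
   [/\ bad f e b (len ak.2.+1),
   complex.Re ak.1 <= complex.Re b <= complex.Re ak.1 + len ak.2.+1 &
   complex.Im ak.1 <= complex.Im b <= complex.Im ak.1 + len ak.2.+1].
  have [/bad_quarter[b [|]]|] := pselect (bad f e ak.1 (len ak.2)).
  - by rewrite -lenS => ?; exists b.
  - by rewrite ltNge ltW.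
  - by move=> ?; exists 0.
have [nxt nxtP] := choice step.
pose c := fix c k := if k is k'.+1 then nxt (c k', k') else a.
have cbad k : bad f e (c k) (len k).
  elim: k => [|k IH]; first by rewrite /len expr0 divr1.
  by have [] := nxtP (c k, k) IH.
have cS k := nxtP (c k, k) (cbad k).
have [x xP] : exists x, forall k, complex.Re (c k) <= x <= complex.Re (c k) + len k.
  apply: nested_intervals => k; last exact: ltW.
  - by have [_ /andP[]] := cS k.
  - have [_ /andP[_]] := cS k; rewrite /= lenS; lra.
have [y yP] : exists x, forall k, complex.Im (c k) <= x <= complex.Im (c k) + len k.
  apply: nested_intervals => k; last exact: ltW.
  - by have [_ _ /andP[]] := cS k.
  - have [_ _ /andP[_]] := cS k; rewrite /= lenS; lra.
have [d fdp] : exists d, cdiff f (x +i* y)%C d.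
  apply: fd; rewrite /in_square /=; have := xP 0%N; have := yP 0%N.
  by rewrite /len expr0 divr1 /= => -> ->.
set p := (x +i* y)%C in fdp.
(* With side l, points of the square are within 2 l of [p] and the perimeter is 4 l, so the
   remainder contributes at most (e / 8) (2 l) (4 l) = e l^2. *)
have e8 : 0 < e / 8 by rewrite divr_gt0.
have [r r0 rP] := fdp _ e8.
have [k kr] : exists k, len k < r / 2 by apply: small_dyadic; lra.
have [n _] := cbad k 0%N; rewrite ltNge => /negP; apply.
pose E z := f z - f p - d * (z - p).
have -> : sqsum n f (c k) (len k)%:C%C = sqsum n E (c k) (len k)%:C%C.
  rewrite -[RHS]addr0 -[X in _ + X](sqsum_affine n (f p - d * p) d (c k) (len k)%:C%C).
  by rewrite -sqsumD; apply: sqsum_eq => z; rewrite /E; ring.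
have lk := len_gt0 k.
apply: le_trans (sqsum_le (M := e / 8 * (2 * len k)) _ (ltW lk) _) _; last first.
  by rewrite expr2; nra.
move=> z /andP[zx zy] _.
have zp : nm (z - p) <= 2 * len k.
  apply: le_trans (nm_le_ReIm _) _.
  have /andP[x1 x2] := xP k; have /andP[y1 y2] := yP k.
  move: zx zy => /andP[? ?] /andP[? ?].
  have -> : complex.Re (z - p) = complex.Re z - x by case: (z).
  have -> : complex.Im (z - p) = complex.Im z - y by case: (z).
  have : `|complex.Re z - x| <= len k by rewrite ler_norml; apply/andP; split; lra.
  have : `|complex.Im z - y| <= len k by rewrite ler_norml; apply/andP; split; lra.
  by lra.
apply: le_trans (rP _ _) _; first by apply: le_lt_trans zp _; lra.
by rewrite ler_wpM2l// ltW.
Qed.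

End Goursat.

(** * Contour sums over squares centred at 0 *)

Section CenterBound.
Variable R : realType.
Local Notation C := (Cx R).
Local Notation I := ('i%C : C).
Implicit Types (f g : C -> C) (a p d z : C) (s r : R).

Lemma cdiffP f z : (exists d, cdiff f z d) <-> derivable f z 1.
Proof.
split=> [[d /cdiff_is_derive[]//]|fz]; exists ('D_1 f z).
exact/is_derive_cdiff/derivableP.
Qed.

Lemma cdiff_shift f a z d : cdiff f (a + z) d -> cdiff (fun w => f (a + w)) z d.
Proof.
move=> fd e /fd[r r0 rP]; exists r => // w wz.
by have := rP (a + w); rewrite opprD addrACA subrr add0r => /(_ wz).
Qed.

(** The factor [u] will be the sign 1 or -1 with which a side enters [sqsum]. *)
Lemma rsum_Im_ge n f p d (u : C) (m : R) :
  (forall t : R, 0 <= t <= 1 -> m <= complex.Im (u * (d * f (p + t%:C%C * d)))) ->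
  m <= complex.Im (u * rsum n f p d).
Proof.
have h2 : (2^-1 : R)%:C%C = 2^-1 :> C by rewrite fmorphV rmorph_nat.
elim: n p d m => [|n IH] p d m fm /=.
  by have := fm 0; rewrite lexx ler01 mul0r addr0 => /(_ isT).
have ImD (x y : C) : complex.Im (x + y) = complex.Im x + complex.Im y.
  by case: x y => ? ? [].
have Im2 (x y : C) : complex.Im (u * (x / 2 * y)) = complex.Im (u * (x * y)) / 2.
  have -> : u * (x / 2 * y) = u * (x * y) * (2^-1 : R)%:C%C by rewrite h2; ring.
  by case: (u * (x * y)) => a b /=; ring.
have -> : m = m / 2 + m / 2 by field.
rewrite mulrDr ImD; apply: lerD; apply: IH => t /andP[t0 t1].
  rewrite Im2 ler_pM2r ?invr_gt0//.
  have := fm (t / 2); rewrite rmorphM /= h2 -[_ / 2 * d]mulrA [_ * d]mulrC.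
  by apply; apply/andP; split; lra.
rewrite Im2 ler_pM2r ?invr_gt0//.
have -> : p + d / 2 + t%:C%C * (d / 2) = p + (2^-1 + t / 2)%:C%C * d.
  by rewrite rmorphD rmorphM /= h2; ring.
by apply: fm; apply/andP; split; lra.
Qed.

Definition csum n f s : C := sqsum n f (- s +i* - s)%C (2 * s)%:C%C.

(* Stands in for the value 2 pi i of the integral of dz / z. *)
Lemma csum_inv_ge n s : 0 < s -> 4 <= nm (csum n (fun z => z^-1) s).
Proof.
move=> s0; apply: le_trans (nm_Im _); apply: le_trans (ler_norm _).
(* On the side z = s + i v the imaginary part of 2 s i / z is 2 s^2 / (v^2 + s^2), which is at least
   1 for |v| <= s. The other sides give the same expression, whence 4. *)
have key (x : R) : 0 <= x <= 1 ->
    1 <= 2 * s ^+ 2 / ((- s + x * (2 * s)) ^+ 2 + s ^+ 2).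
  move=> /andP[x0 x1]; have s2 : 0 < s ^+ 2 by rewrite exprn_gt0.
  rewrite ler_pdivlMr; last by rewrite ltr_wpDl ?sqr_ge0.
  have : 0 <= x * (1 - x) * s ^+ 2 by rewrite mulr_ge0 ?sqr_ge0// mulr_ge0// subr_ge0.
  by rewrite !expr2; nra.
have nz (x : R) : (- s + x * (2 * s)) ^+ 2 + s ^+ 2 != 0.
  by rewrite lt0r_neq0// ltr_wpDl ?sqr_ge0// exprn_gt0.
have sE : - s + 2 * s = s by ring.
set a := (- s +i* - s)%C : C; set d := (2 * s)%:C%C : C.
have b1 : 1 <= complex.Im (1 * rsum n (fun z => z^-1) a d).
  apply: rsum_Im_ge => t /key; congr (_ <= _); rewrite /a /d /=; field.
  by rewrite ?sE ?sqrrN// addrC.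
have b2 : 1 <= complex.Im (1 * rsum n (fun z => z^-1) (a + d) (I * d)).
  apply: rsum_Im_ge => t /key; congr (_ <= _); rewrite /a /d /=; field.
  by rewrite ?sE ?sqrrN// addrC.
have b3 : 1 <= complex.Im (-1 * rsum n (fun z => z^-1) (a + I * d) d).
  apply: rsum_Im_ge => t /key; congr (_ <= _); rewrite /a /d /=; field.
  by rewrite ?sE ?sqrrN// addrC.
have b4 : 1 <= complex.Im (-1 * rsum n (fun z => z^-1) a (I * d)).
  apply: rsum_Im_ge => t /key; congr (_ <= _); rewrite /a /d /=; field.
  by rewrite ?sE ?sqrrN// addrC.
move: b1 b2 b3 b4; rewrite /csum /sqsum -/a -/d.
move: (rsum _ _ _ _) (rsum _ _ _ _) (rsum _ _ _ _) (rsum _ _ _ _).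
by move=> [? ?] [? ?] [? ?] [? ?] /=; lra.
Qed.

Lemma csumD n f g s : csum n (fun z => f z + g z) s = csum n f s + csum n g s.
Proof. exact: sqsumD. Qed.

(** The perimeter is 8 s, and the boundary of the square lies between the circles of radii s and 2
    s. *)
Lemma csum_le n f s M : 0 < s ->
  (forall z, s <= nm z <= 2 * s -> nm (f z) <= M) -> nm (csum n f s) <= 8 * s * M.
Proof.
move=> s0 fM; have -> : 8 * s * M = 4 * (2 * s) * M by ring.
apply: sqsum_le; first by lra.
move=> z /andP[/= /andP[x1 x2] /andP[y1 y2]] zs; apply: fM.
have := nm_Re z; have := nm_Im z; have := nm_le_ReIm z.
have : `|complex.Re z| <= s by rewrite ler_norml; apply/andP; split; lra.
have : `|complex.Im z| <= s by rewrite ler_norml; apply/andP; split; lra.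
move=> ? ? ? ? ?; apply/andP; split; last by lra.
have [->|->] : s = `|complex.Re z| \/ s = `|complex.Im z|; try by [].
have E1 : - s + 2 * s = s by ring.
move: zs; rewrite /on_sides /= E1 => /or4P[] /eqP ->;
  rewrite ?normrN (gtr0_norm s0); solve [by left | by right].
Qed.

(* The squares with half-sides s and s / 2 differ by 12 squares on which f is
   differentiable. *)
Lemma csum_half f s : 0 < s ->
  (forall z, z != 0 -> nm z <= 2 * s -> exists d, cdiff f z d) ->
  forall e, 0 < e -> exists N, forall n, (N <= n)%N ->
    nm (csum n.+1 f s - csum n f (s / 2)) <= e.
Proof.
move=> s0 fd e e0.
have h2 (x : R) : (x / 2)%:C%C = x%:C%C / 2 :> C by rewrite rmorphM /= fmorphV rmorph_nat.
(* Corners of a 4 by 4 grid of mesh s / 2. The four squares with both indices in {1, 2} make up the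
   inner square and are the only ones that contain 0. *)
pose b (i j : nat) : C := ((i%:R / 2 - 1) * s +i* ((j%:R / 2 - 1) * s))%C.
pose t : R := s / 2.
have st : s = 2 * t by rewrite /t; field.
have good i j : (i < 4)%N -> (j < 4)%N ->
    ~~ ((i \in [:: 1; 2]%N) && (j \in [:: 1; 2]%N)) ->
  exists N, forall n, (N <= n)%N -> nm (sqsum n f (b i j) t%:C%C) <= e / 12.
  move=> i4 j4 ij; apply: goursat; [by rewrite /t; lra| |by lra].
  have i3 : i%:R <= 3 :> R by rewrite ler_nat.
  have j3 : j%:R <= 3 :> R by rewrite ler_nat.
  have i0 : 0 <= i%:R :> R by [].
  have j0 : 0 <= j%:R :> R by [].
  move=> z /andP[/= /andP[x1 x2] /andP[y1 y2]]; apply: fd.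
    apply: contraNneq ij => z0; move: x1 x2 y1 y2; rewrite z0 /= => x1 x2 y1 y2.
    have : (0 < i < 3)%N.
      by rewrite -(ltr_nat R) -(ltr_nat R i); apply/andP; split; rewrite /t in x2; nra.
    have : (0 < j < 3)%N.
      by rewrite -(ltr_nat R) -(ltr_nat R j); apply/andP; split; rewrite /t in y2; nra.
    by move: i j {i4 j4 i3 j3 i0 j0 x1 x2 y1 y2} => [|[|[|i]]] [|[|[|j]]].
  apply: le_trans (nm_le_ReIm _) _.
  have : `|complex.Re z| <= s.
    by rewrite /t in x2; rewrite ler_norml; apply/andP; split; nra.
  have : `|complex.Im z| <= s.
    by rewrite /t in y2; rewrite ler_norml; apply/andP; split; nra.
  by lra.
have {}good (ij : nat * nat) : exists N, (ij.1 < 4)%N -> (ij.2 < 4)%N ->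
    ~~ ((ij.1 \in [:: 1; 2]%N) && (ij.2 \in [:: 1; 2]%N)) ->
    forall n, (N <= n)%N -> nm (sqsum n f (b ij.1 ij.2) t%:C%C) <= e / 12.
  have [[[i4 j4] ij']|H] := pselect ((((ij.1 < 4)%N /\ (ij.2 < 4)%N)) /\
    ~~ ((ij.1 \in [:: 1; 2]%N) && (ij.2 \in [:: 1; 2]%N))).
    by have [N NP] := good _ _ i4 j4 ij'; exists N.
  by exists 0%N => *; case: H.
have [N NP] := choice good.
pose M := (\max_(i < 4) \max_(j < 4) N (val i, val j))%N.
have MP i j n : (i < 4)%N -> (j < 4)%N -> (M <= n)%N -> (N (i, j) <= n)%N.
  move=> i4 j4; apply: leq_trans.
  apply: leq_trans (@leq_bigmax _ (fun i : 'I_4 => \max_(j < 4) N (val i, val j))%N (Ordinal i4)).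
  exact: (@leq_bigmax _ (fun j : 'I_4 => N (i, val j))%N (Ordinal j4)).
exists M.+1 => -[//|n]; rewrite ltnS => Mn.
have P i j (i4 : (i < 4)%N) (j4 : (j < 4)%N) ij := NP (i, j) i4 j4 ij n (MP i j n i4 j4 Mn).
(* Two subdivisions of the outer square and one of the inner square reach the same mesh at the same
   level [n], so the four inner terms cancel. *)
have E : csum n.+2 f s - csum n.+1 f (s / 2) =
  sqsum n f (b 0%N 0%N) t%:C%C + sqsum n f (b 1%N 0%N) t%:C%C
  + sqsum n f (b 2%N 0%N) t%:C%C + sqsum n f (b 3%N 0%N) t%:C%C
  + sqsum n f (b 0%N 1%N) t%:C%C + sqsum n f (b 3%N 1%N) t%:C%C
  + sqsum n f (b 0%N 2%N) t%:C%C + sqsum n f (b 3%N 2%N) t%:C%C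
  + sqsum n f (b 0%N 3%N) t%:C%C + sqsum n f (b 1%N 3%N) t%:C%C
  + sqsum n f (b 2%N 3%N) t%:C%C + sqsum n f (b 3%N 3%N) t%:C%C.
  have sq4 m c (x y : R) (u : R) : c = (x +i* y)%C -> sqsum m.+1 f c (2 * u)%:C%C =
     sqsum m f (x +i* y)%C u%:C%C + sqsum m f ((x + u) +i* y)%C u%:C%C +
     sqsum m f (x +i* (y + u))%C u%:C%C + sqsum m f ((x + u) +i* (y + u))%C u%:C%C.
    move=> ->; rewrite sqsumS -h2; have -> : 2 * u / 2 = u by field.
    have e1 : (x +i* y)%C + u%:C%C = ((x + u) +i* y)%C :> C.
      by apply/eqP; rewrite eq_complex /= addr0 !eqxx.
    have e2 x' : (x' +i* y)%C + I * u%:C%C = (x' +i* (y + u))%C :> C.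
      by apply/eqP; rewrite eq_complex /=; apply/andP; split; apply/eqP; ring.
    by rewrite e1 !e2.
  rewrite /csum (sq4 n.+1 _ (- s) (- s))// (sq4 n _ (- (s / 2)) (- (s / 2)))//.
  have -> : s%:C%C = (2 * t)%:C%C :> C by rewrite -st.
  rewrite !(sq4 n _ _ _ _ erefl) /b -/t.
  have c0 : (0%:R / 2 - 1) * s = - s :> R by ring.
  have c1 : (1%:R / 2 - 1) * s = - t :> R by rewrite st; field.
  have c2 : (2%:R / 2 - 1) * s = 0 :> R by field.
  have c3 : (3%:R / 2 - 1) * s = t :> R by rewrite st; field.
  have d1 : - s + t = - t by rewrite st; ring.
  have d2 : - s + s = 0 by ring.
  have d3 : - t + t = 0 by ring.
  rewrite c0 c1 c2 c3 !d2 !d1 !d3 !add0r; ring.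
rewrite E; have -> : e = e / 12 + e / 12 + e / 12 + e / 12 + e / 12 + e / 12 +
    e / 12 + e / 12 + e / 12 + e / 12 + e / 12 + e / 12 by field.
by do 11 (apply: nmD_le; last exact: P); exact: P.
Qed.

End CenterBound.

(** * Cauchy estimates *)

Section CauchyEstimates.
Variable R : realType.
Local Notation C := (Cx R).
Implicit Types (f g h : C -> C) (z w c : C) (r M e : R).

Lemma csumZ n (c : C) f r : csum n (fun z => c * f z) r = c * csum n f r.
Proof.
have E p d : rsum n (fun z => c * f z) p d = c * rsum n f p d.
  by elim: n p d => [|n IH] p d /=; rewrite ?IH; ring.
by rewrite /csum /sqsum !E; ring.
Qed.

(** The level grows by one with each doubling of the square, which keeps the step of the sums
    equal. *)
Lemma csum_dyadic f r : 0 < r ->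
  (forall z, z != 0 -> nm z <= 2 * r -> exists d, cdiff f z d) ->
  forall k e, 0 < e -> exists N, forall n, (N <= n)%N ->
    nm (csum (n + k) f r - csum n f (r / 2 ^+ k)) <= e.
Proof.
move=> r0 fd; elim=> [|k IH] e e0.
  by exists 0%N => n _; rewrite addn0 expr0 divr1 subrr nm0 ltW.
have e20 : 0 < e / 2 by lra.
have [N1 P1] := IH _ e20.
have rk0 : 0 < r / 2 ^+ k by rewrite divr_gt0// exprn_gt0.
have rkr : r / 2 ^+ k <= r.
  by rewrite ler_pdivrMr ?exprn_gt0// ler_peMr ?(ltW r0)// exprn_ege1// ler1n.
have fdk z : z != 0 -> nm z <= 2 * (r / 2 ^+ k) -> exists d, cdiff f z d.
  by move=> z0 zr; apply: fd => //; apply: le_trans zr _; lra.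
have [N2 P2] := csum_half rk0 fdk e20.
exists (maxn N1 N2) => n; rewrite geq_max => /andP[n1 n2].
have -> : e = e / 2 + e / 2 by field.
have E : r / 2 ^+ k / 2 = r / 2 ^+ k.+1 by rewrite exprSr invfM mulrA.
rewrite -E addnS -addSn; apply: le_trans (nm_sub _ (csum n.+1 f (r / 2 ^+ k)) _) _.
by apply: lerD; [exact/P1/leqW|exact: P2].
Qed.

(** The sums of h(z) / z over the given square and over a tiny one nearly agree, and on the tiny one
    h is nearly h(0), so they are close to h(0) times the sum of 1 / z. At 0 only continuity is
    assumed, which admits difference quotients extended by the derivative. *)
Lemma center_bound h r M : 0 < r ->
  (forall z, z != 0 -> nm z <= 2 * r -> exists d, cdiff h z d) ->
  (forall e, 0 < e -> exists2 d, 0 < d & forall z, nm z < d -> nm (h z - h 0) <= e) ->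
  (forall z, r <= nm z <= 2 * r -> nm (h z) <= M) -> nm (h 0) <= 2 * M.
Proof.
move=> r0 hd h0c hM.
suff : 4 * nm (h 0) <= 8 * M by lra.
apply/ler_addgt0Pr => e e0.
(* One ninth pays for the change of square, eight ninths for the oscillation of [h] on the tiny
   square of perimeter 8 s. *)
have e90 : 0 < e / 9 by lra.
have [d d0 dP] := h0c _ e90.
have d20 : 0 < d / 2 by lra.
have [k kd] := small_dyadic r0 d20.
set s := r / 2 ^+ k in kd.
have s0 : 0 < s by rewrite divr_gt0// exprn_gt0.
pose g (z : C) : C := h z * z^-1.
have gd z : z != 0 -> nm z <= 2 * r -> exists d, cdiff g z d.
  move=> z0 zr; apply/cdiffP; have /cdiffP hz := hd z z0 zr.
  exact: (dM hz (dV (d_id z) z0)).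
have [N NP] := csum_dyadic r0 gd k e90.
have {NP} := NP N (leqnn N); rewrite -/s => NP.
have K4 := csum_inv_ge N s0.
apply: le_trans (_ : nm (h 0 * csum N (fun z => z^-1) s) <= _).
  by rewrite nmM mulrC ler_wpM2l// nm_ge0.
have -> : h 0 * csum N (fun z => z^-1) s =
    csum (N + k) g r - (csum (N + k) g r - csum N g s)
    - csum N (fun z => (h z - h 0) * z^-1) s.
  rewrite subKr -csumZ; apply/esym/eqP; rewrite subr_eq -csumD; apply/eqP.
  by apply: sqsum_eq => z; rewrite /g; ring.
have -> : 8 * M + e = 8 * M + e / 9 + 8 * (e / 9) by field.
apply: le_trans (nmB _ _) _; apply: lerD.
  apply: le_trans (nmB _ _) _; apply: lerD => //.
  have -> : 8 * M = 8 * r * (M / r) by field; exact: lt0r_neq0.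
  apply: csum_le => // z /[dup] zr /andP[z1 z2]; rewrite nmM nmV.
  apply: ler_pM; rewrite ?nm_ge0 ?invr_ge0 ?nm_ge0 ?hM//.
  by rewrite lef_pV2 ?posrE//; apply: lt_le_trans z1.
have -> : 8 * (e / 9) = 8 * s * (e / 9 / s) by field; exact: lt0r_neq0.
apply: csum_le => // z /andP[z1 z2]; rewrite nmM nmV.
apply: ler_pM; rewrite ?nm_ge0 ?invr_ge0 ?nm_ge0//.
  by apply: dP; lra.
by rewrite lef_pV2 ?posrE//; apply: lt_le_trans z1.
Qed.

Lemma cdiff_near f g z d : (\forall w \near z, f w = g w) -> cdiff f z d -> cdiff g z d.
Proof.
move=> /nbhs_nmP[r r0 rP] fd e /fd[r' r'0 r'P].
exists (Num.min r r'); first by rewrite lt_min r0.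
move=> w; rewrite lt_min => /andP[w1 w2]; rewrite -!rP ?subrr ?nm0//.
exact: r'P.
Qed.

Definition slope f c d : C -> C :=
  fun z => if z == 0 then d else (f (c + z) - f c) / z.

Lemma slope_cdiff f c d z : z != 0 -> (exists d', cdiff f (c + z) d') ->
  exists d', cdiff (slope f c d) z d'.
Proof.
move=> z0 [d' /cdiff_shift fd].
have /cdiffP[dq dqP] : derivable (fun w => (f (c + w) - f c) / w) z 1.
  have fz : derivable (fun w => f (c + w)) z 1 by apply/cdiffP; exists d'.
  exact: (dM (dB fz (d_cst (f c) z)) (dV (d_id z) z0)).
exists dq; apply: cdiff_near dqP; apply/nbhs_nmP; exists (nm z); first by rewrite nm_gt0.
move=> w wz; rewrite /slope; case: eqP => // w0.
by move: wz; rewrite w0 sub0r nmN ltxx.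
Qed.

Lemma slope_cont f c d e : cdiff f c d -> 0 < e ->
  exists2 r, 0 < r & forall z, nm z < r -> nm (slope f c d z - slope f c d 0) <= e.
Proof.
move=> fd e0; have [r r0 rP] := fd e e0; exists r => // z zr.
rewrite /slope eqxx; case: eqP => [|/eqP z0]; first by rewrite subrr nm0 ltW.
have := rP (c + z); rewrite addrC addKr => /(_ zr) H.
have -> : (f (c + z) - f c) / z - d = (f (c + z) - f c - d * z) / z by field.
by rewrite nmM nmV ler_pdivrMr ?nm_gt0// addrC.
Qed.

(** The derivative is the central value of the difference quotient extended by continuity, so it is
    bounded by the values of the quotient on an annulus. *)
Lemma cauchy_estimate f c d r M : 0 < r -> cdiff f c d ->
  (forall z, nm (z - c) <= 2 * r -> exists d, cdiff f z d) ->
  (forall z, nm (z - c) <= 2 * r -> nm (f z - f c) <= M) ->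
  nm d <= 2 * (M / r).
Proof.
move=> r0 fcd fd fM; have -> : d = slope f c d 0 by rewrite /slope eqxx.
apply: (center_bound r0).
- by move=> z z0 zr; apply: slope_cdiff => //; apply: fd; rewrite addrC addKr.
- by move=> e e0; exact: slope_cont.
move=> z /andP[z1 z2]; have z0 : z != 0 by rewrite -nm_gt0; exact: lt_le_trans z1.
rewrite /slope (negbTE z0) nmM nmV; apply: ler_pM; rewrite ?nm_ge0 ?invr_ge0 ?nm_ge0//.
  by apply: fM; rewrite addrC addKr.
by rewrite lef_pV2 ?posrE//; apply: lt_le_trans z1.
Qed.

Lemma line_derive f (a b d : C) (t : R) : cdiff f (a + t%:C%C * b) d ->
  is_derive t (1 : R) (fun t : R => complex.Re (f (a + t%:C%C * b)))
    (complex.Re (d * b)).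
Proof.
move=> fd.
have fl : (fun h : R => h^-1 *: (((fun t : R => complex.Re (f (a + t%:C%C * b)))
    \o shift t) (h *: 1) - complex.Re (f (a + t%:C%C * b)))) @ 0^'
    --> complex.Re (d * b).
  apply/cvgrPdist_le => e e0.
  have e1 : 0 < e / (nm b + 1) by rewrite divr_gt0// ltr_wpDl ?nm_ge0.
  have b1 : 0 < nm b + 1 by rewrite ltr_wpDl ?nm_ge0.
  have [r r0 rP] := fd _ e1.
  apply/nbhs_ballP; exists (r / (nm b + 1)); first by rewrite /= divr_gt0.
  move=> h; rewrite /ball /= sub0r normrN ltr_pdivlMr// => hr h0.
  rewrite /GRing.scale /= mulr1.
  have E : a + (h + t)%:C%C * b - (a + t%:C%C * b) = h%:C%C * b.
    by rewrite rmorphD /=; ring.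
  have := rP (a + (h + t)%:C%C * b); rewrite E nmM nm_real => /(_ _)/wrap[|].
    by apply: le_lt_trans hr; rewrite ler_wpM2l// lerDl.
  set u := f _ - f _ - _ => H.
  have -> : complex.Re (d * b) - h^-1 * (complex.Re (f (a + (h + t)%:C%C * b)) -
      complex.Re (f (a + t%:C%C * b))) = - (h^-1 * complex.Re u).
    rewrite /u; move: (f _) (f _) => [x1 y1] [x2 y2].
    have -> : d * (h%:C%C * b) = h%:C%C * (d * b) by ring.
    by move: (d * b) => [x3 y3] /=; field.
  rewrite normrN normrM normfV mulrC ler_pdivrMr ?normr_gt0//.
  apply: le_trans (nm_Re _) _; apply: le_trans H _.
  have h0' : 0 < `|h| by rewrite normr_gt0.
  rewrite mulrAC ler_pdivrMr// [X in _ <= X]mulrAC -mulrA ler_wpM2l ?(ltW e0)//.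
  by rewrite mulrC ler_wpM2r// lerDl.
split; first by apply/cvg_ex; exists (complex.Re (d * b)).
exact: cvg_lim.
Qed.

Lemma cdiffZ f (u z d : C) : cdiff f z d -> cdiff (fun w => u * f w) z (u * d).
Proof. by move=> /cdiff_is_derive fd; apply: is_derive_cdiff. Qed.

(* The real mean value theorem is applied to the component of f in the
   direction of f (a + b) - f a. *)
Lemma mean_value_bound f (a b : C) M : 0 <= M ->
  (forall t : R, 0 <= t <= 1 -> exists2 d, cdiff f (a + t%:C%C * b) d & nm d <= M) ->
  nm (f (a + b) - f a) <= M * nm b.
Proof.
move=> M0 fM; have [E|E] := eqVneq (f (a + b) - f a) 0.
  by rewrite E nm0 mulr_ge0// nm_ge0.
pose u : C := (nm (f (a + b) - f a))%:C%C / (f (a + b) - f a).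
have u1 : nm u = 1.
  by rewrite /u nmM nm_real nmV ger0_norm ?nm_ge0// divff// nm_eq0.
have /choice[fd fdP] : forall t : R, exists d, 0 <= t <= 1 ->
    cdiff (fun z => u * f z) (a + t%:C%C * b) d /\ nm d <= M.
  move=> t; have [t01|t01] := boolP (0 <= t <= 1); last by exists 0.
  have [d dP dM] := fM t t01; exists (u * d) => _; split; last by rewrite nmM u1 mul1r.
  exact: cdiffZ.
pose phi (t : R) := complex.Re (u * f (a + t%:C%C * b)).
have phid (t : R) : 0 <= t <= 1 -> is_derive t (1 : R) phi (complex.Re (fd t * b)).
  by move=> /fdP[H _]; exact: (line_derive H).
have phic : {within `[0 : R, 1], continuous phi}.
  have phiD : {in `[0 : R, 1]%R, forall t, derivable phi t 1}.
    by move=> t; rewrite in_itv /= => /phid[].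
  exact: derivable_within_continuous phiD.
have phiD t : t \in `]0 : R, 1[%R -> is_derive t (1 : R) phi (complex.Re (fd t * b)).
  by rewrite in_itv /= => /andP[t0 t1]; apply: phid; rewrite !ltW.
have [t] := MVT_segment ler01 phiD phic.
rewrite in_itv /= => t01; rewrite subr0 mulr1 /phi.
have -> : complex.Re (u * f (a + 1%:C%C * b)) - complex.Re (u * f (a + 0%:C%C * b)) =
    nm (f (a + b) - f a).
  have -> : nm (f (a + b) - f a) = complex.Re (u * (f (a + b) - f a)).
    by rewrite /u divfK.
  have ReMB (x y z : C) : complex.Re (x * y) - complex.Re (x * z) =
      complex.Re (x * (y - z)).
    by case: x y z => [? ?] [? ?] [? ?] /=; ring.
  by rewrite !rmorph1 rmorph0 mul0r mul1r addr0 ReMB.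
move=> ->; apply: le_trans (ler_norm _) _; apply: le_trans (nm_Re _) _.
by rewrite nmM ler_wpM2r ?nm_ge0//; have [] := fdP t t01.
Qed.

End CauchyEstimates.

(** * Regularity and factorization of holomorphic functions *)

Section Holomorphic.
Variable R : realType.
Local Notation C := (Cx R).
Implicit Types (f g F : C -> C) (z w c h k : C) (r s M K e : R).

Lemma cdiffB f g z d d' : cdiff f z d -> cdiff g z d' ->
  cdiff (fun w => f w - g w) z (d - d').
Proof.
by move=> /cdiff_is_derive fd /cdiff_is_derive gd; apply: is_derive_cdiff.
Qed.

Lemma cdiff_cst (a : C) z : cdiff (fun=> a) z 0.
Proof. by apply: is_derive_cdiff; exact: is_derive_cst. Qed.

Lemma cdiff_id z : cdiff id z 1.
Proof. by apply: is_derive_cdiff; exact: is_derive_id. Qed.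

Lemma derivable_cdiff f z : derivable f z 1 -> cdiff f z ('D_1 f z).
Proof. by move=> fz; exact/is_derive_cdiff/derivableP. Qed.

(** The limit is the supremum of the lower bounds [Q h - K * nm h], all of which lie below all upper
    bounds [Q k + K * nm k]; this yields the rate of convergence at once. *)
Lemma real_limit0 (Q : C -> R) s K : 0 < s ->
  (forall h k, 0 < nm h <= s -> 0 < nm k <= s -> `|Q h - Q k| <= K * (nm h + nm k)) ->
  exists L, forall h, 0 < nm h <= s -> `|Q h - L| <= K * nm h.
Proof.
move=> s0 QK; pose E := [set Q h - K * nm h | h in [set h | 0 < nm h <= s]].
have sE : 0 < nm (s%:C%C : C) <= s by rewrite nm_real gtr0_norm// s0 lexx.
have E0 : E !=set0 by exists (Q s%:C%C - K * nm s%:C%C), s%:C%C.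
have ubE k : 0 < nm k <= s -> ubound E (Q k + K * nm k).
  move=> ks _ [h hs <-]; have := QK h k hs ks; rewrite ler_norml => /andP[]; lra.
exists (sup E) => h hs; rewrite ler_norml; apply/andP; split.
  by have := ge_sup E0 (ubE h hs); lra.
have : Q h - K * nm h <= sup E.
  apply: sup_upper_bound; last by exists h.
  by split => //; exists (Q s%:C%C + K * nm s%:C%C); exact: ubE.
lra.
Qed.

Lemma complex_limit0 (Q : C -> C) s K : 0 < s ->
  (forall h k, 0 < nm h <= s -> 0 < nm k <= s -> nm (Q h - Q k) <= K * (nm h + nm k)) ->
  exists L, forall h, 0 < nm h <= s -> nm (Q h - L) <= 2 * K * nm h.
Proof.
move=> s0 QK.
have [|x xP] := @real_limit0 (fun h => complex.Re (Q h)) s K s0.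
  move=> h k hs ks; apply: le_trans (QK h k hs ks).
  by apply: le_trans (nm_Re _); case: (Q h) (Q k) => ? ? [].
have [|y yP] := @real_limit0 (fun h => complex.Im (Q h)) s K s0.
  move=> h k hs ks; apply: le_trans (QK h k hs ks).
  by apply: le_trans (nm_Im _); case: (Q h) (Q k) => ? ? [].
exists (x +i* y)%C => h hs; apply: le_trans (nm_le_ReIm _) _.
have := xP h hs; have := yP h hs; case: (Q h) => a b /=; lra.
Qed.

(** The quotients q_h = (f(z + h) - f(z)) / h tend to f' at a rate K |h| that is uniform near c. A
    Cauchy estimate for q_h - q_k transfers this rate to their derivatives at c, which are the
    difference quotients of f'; these therefore converge. *)
Lemma derivative_cdiff f c r : 0 < r ->
  (forall z, nm (z - c) < r -> derivable f z 1) ->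
  exists L, cdiff (fun z => 'D_1 f z) c L.
Proof.
move=> r0 fr; pose d z := 'D_1 f z.
have fd z : nm (z - c) < r -> cdiff f z (d z) by move=> /fr/derivable_cdiff.
have cc : nm (c - c) < r by rewrite subrr nm0.
have [r1 r10 r1P] := cdiff_cont (fd c cc) ltr01.
(* Each Cauchy estimate consumes a margin 2 s and each shift by [h] a margin s; the radii 8 s, 5 s,
   4 s, 2 s below leave room for both. *)
pose s := Num.min r r1 / 8.
have s0 : 0 < s by rewrite /s divr_gt0// lt_min r0.
have s8 : Num.min r r1 = 8 * s by rewrite /s; field.
have {}fd z : nm (z - c) < 8 * s -> cdiff f z (d z).
  by rewrite -s8 lt_min => /andP[/fd].
have fb z w : nm (z - c) < 8 * s -> nm (w - c) < 8 * s -> nm (f z - f w) <= 2.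
  rewrite -s8 !lt_min => /andP[_ /r1P z1] /andP[_ /r1P w1].
  by apply: le_trans (nm_sub _ (f c) _) _; rewrite (nmBC (f c)); lra.
have tri z w v a b : nm (z - w) <= a -> nm (w - v) <= b -> nm (z - v) <= a + b.
  by move=> ? ?; apply: le_trans (nm_sub _ w _) _; exact: lerD.
have H1 z : nm (z - c) <= 5 * s -> nm (d z) <= 4 / s.
  move=> zc; have -> : 4 / s = 2 * (2 / s) by ring.
  have near w : nm (w - z) <= 2 * s -> nm (w - c) < 8 * s.
    by move=> /tri/(_ zc); lra.
  apply: (@cauchy_estimate _ f z) => //.
  - by apply: fd; lra.
  - by move=> w /near/fd; exists (d w).
  - by move=> w /near wc; apply: fb => //; lra.
have tnm (t : R) (h : C) : 0 <= t <= 1 -> nm (t%:C%C * h) <= nm h.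
  move=> /andP[t0 t1]; rewrite nmM nm_real ger0_norm//.
  by rewrite ler_piMl ?nm_ge0.
have addK (z h w : C) a b : nm (z - w) <= a -> nm h <= b -> nm (z + h - w) <= a + b.
  by move=> ? ?; rewrite addrAC; exact: nmD_le.
have H1' z h : nm (z - c) <= 4 * s -> nm h <= s ->
    nm (f (z + h) - f z) <= 4 / s * nm h.
  move=> zc hs; apply: mean_value_bound; first by rewrite divr_ge0// ltW.
  move=> t /(tnm t h) th.
  have := addK _ _ _ _ _ zc (le_trans th hs) => zt.
  by exists (d (z + t%:C%C * h)); [apply: fd|apply: H1]; lra.
pose K2 := 16 / s ^+ 2.
have K20 : 0 <= K2 by rewrite divr_ge0// exprn_ge0// ltW.
have H2 z h : nm (z - c) <= 2 * s -> nm h <= s -> nm (d (z + h) - d z) <= K2 * nm h.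
  move=> zc hs.
  have -> : K2 * nm h = 2 * ((4 / s * nm h + 4 / s * nm h) / s).
    by rewrite /K2; field; exact: lt0r_neq0.
  have Dd w : nm (w - c) <= 4 * s ->
      cdiff (fun w => f (h + w) - f w) w (d (h + w) - d w).
    move=> wc; apply: cdiffB; last by apply: fd; lra.
    apply: cdiff_shift; apply: fd.
    by rewrite [h + w]addrC; have := addK _ _ _ _ _ wc hs; lra.
  rewrite [z + h]addrC.
  apply: (@cauchy_estimate _ (fun w => f (h + w) - f w) z) => //.
  - by apply: Dd; lra.
  - by move=> w /tri/(_ zc) wc; exists (d (h + w) - d w); apply: Dd; lra.
  - move=> w /tri/(_ zc) wc; apply: le_trans (nmB _ _) _.
    by apply: lerD; rewrite [h + _]addrC; apply: H1' => //; lra.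
have H3 z h : nm (z - c) <= 2 * s -> nm h <= s ->
    nm (f (z + h) - f z - d z * h) <= K2 * nm h * nm h.
  move=> zc hs; pose G w := f w - d z * w.
  have -> : f (z + h) - f z - d z * h = G (z + h) - G z by rewrite /G; ring.
  apply: mean_value_bound; first by rewrite mulr_ge0// nm_ge0.
  move=> t /(tnm t h) th; have ths := le_trans th hs.
  exists (d (z + t%:C%C * h) - d z * 1).
    apply: cdiffB; last by apply: cdiffZ; exact: cdiff_id.
    by apply: fd; have := addK _ _ _ _ _ zc ths; lra.
  by rewrite mulr1; apply: le_trans (H2 _ _ zc ths) _; rewrite ler_wpM2l.
pose q h z := h^-1 * (f (h + z) - f z).
have qd h z : nm (z - c) <= 4 * s -> nm h <= s -> cdiff (q h) z (h^-1 * (d (h + z) - d z)).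
  move=> zc hs; apply: cdiffZ; apply: cdiffB; last by apply: fd; lra.
  apply: cdiff_shift; apply: fd.
  by rewrite [h + z]addrC; have := addK _ _ _ _ _ zc hs; lra.
have qe h z : nm (z - c) <= 2 * s -> 0 < nm h <= s -> nm (q h z - d z) <= K2 * nm h.
  move=> zc /andP[h0 hs]; have := H3 z h zc hs.
  have h0' : h != 0 by rewrite -nm_gt0.
  have -> : f (z + h) - f z - d z * h = h * (q h z - d z).
    by rewrite /q [h + z]addrC; field.
  by rewrite nmM mulrC ler_pM2r.
have [L LP] : exists L, forall h, 0 < nm h <= s ->
    nm (h^-1 * (d (h + c) - d c) - L) <= 2 * (4 * K2 / s) * nm h.
  apply: (complex_limit0 s0) => h k hs ks.
  have cs : nm (c - c) <= 2 * s by rewrite subrr nm0; lra.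
  have -> : 4 * K2 / s * (nm h + nm k) =
     2 * ((K2 * nm h + K2 * nm k + (K2 * nm h + K2 * nm k)) / s).
    by field; exact: lt0r_neq0.
  apply: (@cauchy_estimate _ (fun z => q h z - q k z) c) => //.
  - by case/andP: hs => _ hs; case/andP: ks => _ ks; apply: cdiffB; apply: qd => //; lra.
  - move=> z zc; case/andP: hs => _ hs; case/andP: ks => _ ks.
    by eexists; apply: cdiffB; apply: qd => //; lra.
  - have qq z : nm (z - c) <= 2 * s -> nm (q h z - q k z) <= K2 * nm h + K2 * nm k.
      by move=> zc; apply: tri; [exact: qe|rewrite nmBC; exact: qe].
    by move=> z zc; apply: le_trans (nmB _ _) _; apply: lerD; exact: qq.
exists L => e e0; set K3 := 2 * _ in LP.
have K30 : 0 <= K3 by rewrite /K3 mulr_ge0// divr_ge0 ?(ltW s0)// mulr_ge0.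
exists (Num.min s (e / (K3 + 1))).
  by rewrite lt_min s0 divr_gt0// ltr_wpDl.
move=> w; rewrite lt_min => /andP[ws we].
have [->|wc] := eqVneq w c; first by rewrite !subrr mulr0 subr0 nm0 mulr0.
have wc0 : 0 < nm (w - c) by rewrite nm_gt0 subr_eq0.
have := LP (w - c); rewrite wc0 (ltW ws) subrK => /(_ isT) H.
have E (x y v : C) : v != 0 -> x - y - L * v = (v^-1 * (x - y) - L) * v.
  by move=> ?; field.
rewrite (E (d w) (d c)) ?subr_eq0// nmM ler_wpM2r ?nm_ge0//; apply: le_trans H _.
move: we; rewrite ltr_pdivlMr ?ltr_wpDl// => we.
by nra.
Qed.

Definition dquot f c z := slope f c ('D_1 f c) (z - c).

Lemma dquotE f c z : f z = f c + (z - c) * dquot f c z.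
Proof.
rewrite /dquot /slope; case: eqP => [/subr0_eq->|/eqP zc].
  by rewrite subrr mul0r addr0.
by rewrite mulrC divfK// addrC subrKC subrK.
Qed.

(** At [c] the derivative is half the second derivative [L]: the mean value bound turns the
    first-order expansion of f' into a second-order expansion of f. *)
Lemma dquot_derivable f c r z : 0 < r ->
  (forall z, nm (z - c) < r -> derivable f z 1) ->
  nm (z - c) < r -> derivable (dquot f c) z 1.
Proof.
move=> r0 fr zr; apply/cdiffP; have [->|zc] := eqVneq z c; last first.
  have z0 : - c + z != 0 by rewrite addrC subr_eq0.
  have fz : exists d, cdiff f (c + (- c + z)) d.
    by apply/cdiffP; rewrite addNKr; exact: fr.
  have [d /cdiff_shift sd] := slope_cdiff ('D_1 f c) z0 fz; exists d; apply: cdiff_near sd.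
  by apply/nbhs_nmP; exists 1; rewrite ?ltr01// => w _; rewrite /dquot addrC.
have cr : nm (c - c) < r by rewrite subrr nm0.
have fc := derivable_cdiff (fr c cr).
have [L LP] := derivative_cdiff r0 fr.
exists (L / 2) => e e0; have [s s0 sP] := LP e e0.
exists (Num.min r s) => [|w]; first by rewrite lt_min r0.
rewrite lt_min => /andP[wr ws].
have [->|wc] := eqVneq w c; first by rewrite !subrr mulr0 subr0 nm0 mulr0.
have wc0 : w - c != 0 by rewrite subr_eq0.
rewrite /dquot subrr /slope eqxx (negbTE wc0) [c + _]addrC subrK.
pose G z := f z - 'D_1 f c * (z - c) - L / 2 * (z - c) ^+ 2.
have -> : (f w - f c) / (w - c) - 'D_1 f c - L / 2 * (w - c) = (G (c + (w - c)) - G c) / (w - c).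
  by rewrite /G [c + _]addrC subrK; field.
rewrite nmM nmV ler_pdivrMr ?nm_gt0//.
apply: mean_value_bound; first by rewrite mulr_ge0 ?nm_ge0// ltW.
move=> t /andP[t0 t1]; set v := c + _.
have vc : v - c = t%:C%C * (w - c) by rewrite /v addrC addKr.
have vw : nm (v - c) <= nm (w - c).
  by rewrite vc nmM nm_real ger0_norm// ler_piMl ?nm_ge0.
exists ('D_1 f v - 'D_1 f c - L * (v - c)); last first.
  apply: le_trans (sP _ _) _; first exact: le_lt_trans ws.
  by rewrite ler_wpM2l// ltW.
have E (x y u : C) : x - y - L * u =
    x - y * (1 - 0) - L / 2 * (u * (1 - 0) + u * (1 - 0)) by field.
rewrite E.
have id_c : cdiff (fun z => z - c) v (1 - 0).
  by apply: cdiffB; [exact: cdiff_id|exact: cdiff_cst].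
apply: cdiffB; last first.
  apply: cdiffZ; have : is_derive v 1 ((fun z : C => z - c) * (fun z : C => z - c))
      ((v - c) *: (1 - 0) + (v - c) *: (1 - 0)).
    by apply: is_deriveM; exact: cdiff_is_derive.
  exact: is_derive_cdiff.
apply: cdiffB; last exact: cdiffZ.
by apply: derivable_cdiff; apply: fr; exact: le_lt_trans wr.
Qed.

(** Factors z - c are divided out as long as the cofactor vanishes at c. If this never ends,
    [center_bound] for the n-th cofactor gives |f| <= 2 M 3^-n near c for all n. *)
Lemma factorization f c r : 0 < r ->
  (forall z, nm (z - c) < r -> derivable f z 1) ->
  (exists2 s, 0 < s & forall z, nm (z - c) < s -> f z = 0) \/
  exists n (h : C -> C), [/\ forall z, nm (z - c) < r -> derivable h z 1, h c != 0 &
    forall z, f z = (z - c) ^+ n * h z].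
Proof.
move=> r0 fr; set Q := (X in _ \/ X); have [|nQ] := pselect Q; first by right.
left.
have H n : exists2 h : C -> C, forall z, nm (z - c) < r -> derivable h z 1 &
    forall z, f z = (z - c) ^+ n * h z.
  elim: n => [|n [h hr hE]]; first by exists f => // z; rewrite expr0 mul1r.
  have hc : h c = 0.
    by apply/eqP; apply: contrapT => /negP hc; apply: nQ; exists n, h.
  exists (dquot h c) => z; first exact: dquot_derivable.
  by rewrite hE (dquotE h c z) hc add0r exprSr mulrA.
have cr : nm (c - c) < r by rewrite subrr nm0.
have [r1 r10 r1P] := cdiff_cont (derivable_cdiff (fr c cr)) ltr01.
pose s := Num.min r r1 / 4.
have s0 : 0 < s by rewrite /s divr_gt0// lt_min r0.
have s4 : Num.min r r1 = 4 * s by rewrite /s; field.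
pose M := nm (f c) + 1.
have M0 : 0 < M by rewrite ltr_wpDl ?nm_ge0.
have fM z : nm (z - c) < 4 * s -> nm (f z) <= M.
  rewrite -s4 lt_min => /andP[_ /r1P zr]; rewrite -(subrK (f c) (f z)).
  by apply: le_trans (nmD _ _) _; rewrite /M; lra.
(* For [p] within s / 4 of [c], the annulus of radii s and 2 s about [p] keeps the distance 3 s / 4
   from [c]; the quotient of the two distances is the ratio 1 / 3. *)
exists (s / 4) => [|p pc]; first by lra.
apply/eqP; rewrite -nm_eq0 eq_le nm_ge0 andbT; apply/ler_addgt0Pr => e e0; rewrite add0r.
have M20 : 0 < 2 * M by lra.
have [n ne] := small_dyadic M20 e0.
apply: le_trans (ltW ne); have [h hr hE] := H n.
have s34 : 0 < (3 * s / 4) ^+ n by rewrite exprn_gt0//; lra.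
have hM z : 3 * s / 4 <= nm (z - c) -> nm (z - c) < 4 * s -> nm (h z) <= M / (3 * s / 4) ^+ n.
  move=> z1 /fM; rewrite hE nmM nmX ler_pdivlMr// [nm (h z) * _]mulrC; apply: le_trans.
  by rewrite ler_wpM2r ?nm_ge0// lerXn2r ?nnegrE ?nm_ge0//; lra.
have sr : 4 * s <= r by rewrite -s4 ge_min lexx.
have hd (z : C) : nm z <= 2 * s -> derivable h (p + z) 1.
  move=> zs; apply: hr; rewrite addrAC.
  by apply: le_lt_trans (nmD _ _) _; lra.
have hp : nm (h p) <= 2 * (M / (3 * s / 4) ^+ n).
  rewrite -{1}[p]addr0; apply: (@center_bound _ (fun z => h (p + z)) s _ s0).
  - move=> z _ /hd/cdiffP[d dP]; exists d; exact: cdiff_shift.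
  - move=> a a0; have /hd/cdiffP[d] : nm (0 : C) <= 2 * s by rewrite nm0; lra.
    move=> /cdiff_shift/cdiff_cont/(_ _ a0)[b b0 bP]; exists b => // z zb.
    by have := bP z; rewrite subr0 addr0 => /(_ zb)/ltW.
  - move=> z /andP[z1 z2]; apply: hM.
      have := nmB (p + z - c) (p - c); have -> : p + z - c - (p - c) = z by ring.
      by lra.
    by rewrite addrAC; apply: le_lt_trans (nmD _ _) _; lra.
rewrite hE nmM nmX.
apply: le_trans (_ : (s / 4) ^+ n * (2 * (M / (3 * s / 4) ^+ n)) <= _).
  apply: ler_pM; rewrite ?exprn_ge0 ?nm_ge0//.
  by rewrite lerXn2r ?nnegrE ?nm_ge0 ?(ltW pc)//; lra.
have -> : (s / 4) ^+ n * (2 * (M / (3 * s / 4) ^+ n)) = 2 * M * 3^-1 ^+ n.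
  have -> : s / 4 = 3 * s / 4 * 3^-1 by field.
  by rewrite exprMn; field; exact: lt0r_neq0.
rewrite ler_wpM2l ?(ltW M20)// -exprVn lerXn2r ?nnegrE//; lra.
Qed.

End Holomorphic.

(** * Real functions with a holomorphic gradient *)

Section Potentials.
Variable R : realType.
Local Notation C := (Cx R).
Implicit Types (f F : C -> C) (z w c d a b : C) (r s t M e : R) (u : C -> R).

(* d is the complex gradient of u at z: u restricted to any real line
   t |-> a + t b through z has derivative Re (d b) at z. *)
Definition lpot u d z := forall a b t, a + t%:C%C * b = z ->
  is_derive t (1 : R) (fun t : R => u (a + t%:C%C * b)) (complex.Re (d * b)).

Lemma lpot_Re f d z : cdiff f z d -> lpot (fun w => complex.Re (f w)) d z.
Proof. by move=> fd a b t abz; apply: line_derive; rewrite abz. Qed.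

Lemma lpot_Im f d z : cdiff f z d -> lpot (fun w => complex.Im (f w)) (- ('i%C * d)) z.
Proof.
move=> /(cdiffZ (- 'i%C))/lpot_Re; rewrite mulNr => H a b t /H.
congr (is_derive _ _ _ _); apply/funext => s /=.
by case: (f _) => x y /=; ring.
Qed.

Lemma lpot_cst (k : R) z : lpot (fun=> k) 0 z.
Proof. by move=> a b t _; rewrite mul0r; exact: is_derive_cst. Qed.

Lemma lpotD u v d d' z : lpot u d z -> lpot v d' z ->
  lpot (fun w => u w + v w) (d + d') z.
Proof.
move=> ud vd a b t /[dup] /ud H1 /vd H2.
have -> : complex.Re ((d + d') * b) = complex.Re (d * b) + complex.Re (d' * b).
  by case: d d' b {ud vd H1 H2} => [? ?] [? ?] [? ?] /=; ring.
exact: (is_deriveD H1 H2).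
Qed.

Lemma lpotZ (k : R) u d z : lpot u d z -> lpot (fun w => k * u w) (k%:C%C * d) z.
Proof.
move=> ud a b t /ud H.
have -> : complex.Re (k%:C%C * d * b) = k * complex.Re (d * b).
  by case: d b {ud H} => [? ?] [? ?] /=; ring.
exact: (is_deriveZ k H).
Qed.

Lemma lpot_sum n (u : 'I_n -> C -> R) (d : 'I_n -> C) z :
  (forall i, lpot (u i) (d i) z) ->
  lpot (fun w => \sum_(i < n) u i w) (\sum_(i < n) d i) z.
Proof.
elim: n u d => [|n IH] u d ud.
  rewrite big_ord0; have -> : (fun w => \sum_(i < 0) u i w) = fun=> 0.
    by apply/funext => w; rewrite big_ord0.
  exact: lpot_cst.
rewrite big_ord_recl.
have -> : (fun w => \sum_(i < n.+1) u i w) =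
    fun w => u ord0 w + \sum_(i < n) u (lift ord0 i) w.
  by apply/funext => w; rewrite big_ord_recl.
by apply: lpotD => //; apply: IH.
Qed.

Lemma ln_nm z : ln (nm z) = 2^-1 * ln (complex.Re z ^+ 2 + complex.Im z ^+ 2).
Proof.
have -> : complex.Re z ^+ 2 + complex.Im z ^+ 2 = nm z ^+ 2.
  by case: z => x y; rewrite /nm /= sqr_sqrtr// addr_ge0// sqr_ge0.
have [->|z0] := eqVneq z 0; first by rewrite nm0 expr0n /= ln0// mulr0.
by rewrite lnXn ?nm_gt0// mulr2n; field.
Qed.

Lemma lpot_ln f d z : cdiff f z d -> f z != 0 ->
  lpot (fun w => ln (nm (f w))) (d / f z) z.
Proof.
move=> fd fz0 a b t abz.
have H1 := lpot_Re fd abz; have H2 := lpot_Im fd abz.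
set p := fun t : R => complex.Re (f (a + t%:C%C * b)) in H1.
set q := fun t : R => complex.Im (f (a + t%:C%C * b)) in H2.
have -> : (fun t : R => ln (nm (f (a + t%:C%C * b)))) =
    fun t => 2^-1 * ln (p t * p t + q t * q t).
  by apply/funext => s; rewrite ln_nm !expr2.
have pt : p t = complex.Re (f z) by rewrite /p abz.
have qt : q t = complex.Im (f z) by rewrite /q abz.
have N0 : 0 < p t * p t + q t * q t.
  rewrite pt qt -!expr2 lt_def addr_ge0 ?sqr_ge0// andbT.
  rewrite paddr_eq0 ?sqr_ge0// !sqrf_eq0; apply: contra fz0.
  by case: (f z) => x y /= /andP[/eqP-> /eqP->].
have H3 : is_derive t (1 : R) (fun t => p t * p t + q t * q t)
   ((p t * complex.Re (d * b) + p t * complex.Re (d * b)) +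
    (q t * complex.Re (- ('i%C * d) * b) + q t * complex.Re (- ('i%C * d) * b))).
  exact: (is_deriveD (is_deriveM H1 H1) (is_deriveM H2 H2)).
have H4 := @is_derive1_comp _ _ (fun t => p t * p t + q t * q t) t _ _
  (is_derive1_ln N0) H3.
apply: is_derive_eq (is_deriveZ 2^-1 H4) _.
rewrite pt qt in N0 *; rewrite /GRing.scale /=.
move: (f z) fz0 N0 => [x y] /= _ N0; case: d b {fd abz p q H1 H2 pt qt H3 H4} => [? ?] [? ?] /=.
field; exact: lt0r_neq0.
Qed.

Lemma lpot_mvt u F a b :
  (forall t, 0 <= t <= 1 -> lpot u (F (a + t%:C%C * b)) (a + t%:C%C * b)) ->
  exists2 t, 0 < t < 1 & u (a + b) - u a = complex.Re (F (a + t%:C%C * b) * b).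
Proof.
move=> uF; pose phi t := u (a + t%:C%C * b).
have phid t : 0 <= t <= 1 ->
    is_derive t (1 : R) phi (complex.Re (F (a + t%:C%C * b) * b)).
  by move=> /uF H; exact: (H a b t erefl).
have phic : {within `[0 : R, 1], continuous phi}.
  have phiD : {in `[0 : R, 1]%R, forall t, derivable phi t 1}.
    by move=> t; rewrite in_itv /= => /phid[].
  exact: derivable_within_continuous phiD.
have phiD t : t \in `]0 : R, 1[%R ->
    is_derive t (1 : R) phi (complex.Re (F (a + t%:C%C * b) * b)).
  by rewrite in_itv /= => /andP[t0 t1]; apply: phid; rewrite !ltW.
have [t] := MVT ltr01 phiD phic.
rewrite in_itv /= => t01; rewrite subr0 mulr1 => H; exists t => //.
by rewrite -H /phi rmorph1 rmorph0 mul1r mul0r addr0.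
Qed.

Lemma lpot0_const u c r : (forall z, nm (z - c) < r -> lpot u 0 z) ->
  forall z, nm (z - c) < r -> u z = u c.
Proof.
move=> u0 z zr; have [|t _] := @lpot_mvt u (fun=> 0) c (z - c).
  move=> t /andP[t0 t1]; apply: u0; apply: le_lt_trans zr.
  by rewrite addrC addKr nmM nm_real ger0_norm// ler_piMl ?nm_ge0.
by rewrite mul0r [c + _]addrC subrK => /subr0_eq.
Qed.

Lemma lpot_eq0 u d z r : 0 < r -> lpot u d z ->
  (forall w, nm (w - z) < r -> u w = u z) -> d = 0.
Proof.
move=> r0 ud uc.
have H b : complex.Re (d * b) = 0.
  have /ud H : z + (0 : R)%:C%C * b = z by rewrite rmorph0 mul0r addr0.
  have b1 : 0 < nm b + 1 by rewrite ltr_wpDl ?nm_ge0.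
  have : is_derive (0 : R) (1 : R) (cst (u z) : R -> R) (complex.Re (d * b)).
    apply: near_eq_is_derive H.
    apply/nbhs_ballP; exists (r / (nm b + 1)); first by rewrite /= divr_gt0.
    move=> t; rewrite /ball /= sub0r normrN ltr_pdivlMr// => tr.
    apply: uc; rewrite addrC addKr nmM nm_real; apply: le_lt_trans tr.
    by rewrite ler_wpM2l// lerDl.
  move=> /@derive_val <-; exact: derive_cst.
have := H 1; have := H 'i%C; rewrite ReiNIm mulr1.
by case: d {ud H} => x y /= /eqP; rewrite oppr_eq0 => /eqP -> ->.
Qed.

Lemma local_max u F c r : 0 < r ->
  (forall z, nm (z - c) < r -> derivable F z 1) ->
  (forall z, nm (z - c) < r -> lpot u (F z) z) ->
  (forall z, nm (z - c) < r -> u z <= u c) ->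
  exists2 s, 0 < s & forall z, nm (z - c) < s -> u z = u c.
Proof.
move=> r0 Fr uF umax; have [[s s0 F0]|[n [h [hr hc FE]]]] := factorization r0 Fr.
  exists (Num.min r s); first by rewrite lt_min r0.
  apply: lpot0_const => z; rewrite lt_min => /andP[zr zs].
  by rewrite -(F0 z zs); exact: uF.
(* On the ray c + t v with v ^+ n.+1 = 1 / h c, the derivative of u is
   t ^+ n * (1 + o(1)) > 0. *)
exfalso; pose v : C := n.+1.-root (h c)^-1.
have vE : v ^+ n.+1 = (h c)^-1 by rewrite rootCK.
have cr : nm (c - c) < r by rewrite subrr nm0.
have hc0 : 0 < nm (h c) by rewrite nm_gt0.
have [q q0 qP] := cdiff_cont (derivable_cdiff (hr c cr)) hc0.
have v1 : 0 < nm v + 1 by rewrite ltr_wpDl ?nm_ge0.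
pose s := Num.min r q / (nm v + 1).
have s0 : 0 < s / 2 by rewrite !divr_gt0// lt_min r0.
have ts t : 0 <= t <= s / 2 -> nm (c + t%:C%C * v - c) < Num.min r q.
  move=> /andP[t0 t1]; rewrite addrC addKr nmM nm_real ger0_norm//.
  have : t < s by lra.
  rewrite /s ltr_pdivlMr//; apply: le_lt_trans.
  by rewrite ler_wpM2l// lerDl.
pose b := (s / 2)%:C%C * v.
have tb t : t%:C%C * b = (t * (s / 2))%:C%C * v by rewrite /b mulrA -rmorphM.
have [|t /andP[t0 t1]] := @lpot_mvt u F c b.
  move=> t /andP[t0 t1]; apply: uF; rewrite tb.
  have := ts (t * (s / 2)); rewrite lt_min => H.
  have /H/andP[//] : 0 <= t * (s / 2) <= s / 2.
  by rewrite mulr_ge0 ?(ltW s0)//= ler_piMl ?(ltW s0).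
set w := c + t%:C%C * b => E.
have /ts : 0 <= t * (s / 2) <= s / 2.
  by rewrite mulr_ge0 ?(ltW s0) ?(ltW t0)//= ler_piMl ?(ltW s0) ?(ltW t1).
rewrite -tb -/w lt_min => /andP[wr wq].
have br : nm (c + b - c) < r.
  have /ts : 0 <= s / 2 <= s / 2 by rewrite lexx ltW.
  by rewrite lt_min => /andP[].
have := umax _ br; rewrite -subr_le0 E FE leNgt => /negP; apply.
have -> : (w - c) ^+ n * h w * b =
    ((t * (s / 2)) ^+ n * (s / 2))%:C%C * (v ^+ n.+1 * h w).
  have E' (x y : R) : (x ^+ n * y)%:C%C = x%:C%C ^+ n * y%:C%C :> C.
    by rewrite rmorphM rmorphXn.
  by rewrite /w addrC addKr tb exprMn exprS /b E'; ring.
have -> (x : R) (y : C) : complex.Re (x%:C%C * y) = x * complex.Re y.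
  by case: y => ? ? /=; ring.
rewrite vE; apply: mulr_gt0.
  by apply: mulr_gt0 => //; apply: exprn_gt0; apply: mulr_gt0.
have : nm ((h c)^-1 * h w - 1) < 1.
  have -> : (h c)^-1 * h w - 1 = (h c)^-1 * (h w - h c) by field.
  by rewrite nmM nmV mulrC ltr_pdivrMr// mul1r; exact: qP.
move=> /(le_lt_trans (nm_Re _)); case: (_ * h w) => x y /=.
by rewrite ltr_norml => /andP[]; lra.
Qed.

End Potentials.

(** * S-units in local coordinates *)

Lemma clopen_total (T : topologicalType) (P : T -> Prop) :
  connected [set: T] -> (exists t, P t) -> (forall t, P t -> \forall q \near t, P q) ->
  (forall t, ~ P t -> \forall q \near t, ~ P q) -> forall t, P t.
Proof.
move=> Tc [t Pt] Po Pc q.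
have E : [set t | P t] = [set: T].
  apply: Tc; [by exists t| |].
    exists [set t | P t]; last by rewrite setTI.
    by rewrite openE => s /Po.
  exists [set t | P t]; last by rewrite setTI.
  rewrite -openC openE => s /= nPs; exact: Pc.
by have : [set: T] q by []; rewrite -E.
Qed.

Section LocalCoordinates.
Variables (R : realType) (B : riemannSurface R).
Local Notation C := (Cx R).
Implicit Types (p q t : B) (z w : C).

Definition chart_at t : set B * (B -> C) := projT1 (cid2 (@rs_cover R B t)).

Lemma chart_at_atlas t : rs_atlas (chart_at t).
Proof. by rewrite /chart_at; case: cid2. Qed.

Lemma chart_at_mem t : (chart_at t).1 t.
Proof. by rewrite /chart_at; case: cid2. Qed.

Lemma chart_at_nbhs t : nbhs t (chart_at t).1.
Proof.
by apply: open_nbhs_nbhs; split; [exact/rs_chart_open/chart_at_atlas|exact: chart_at_mem].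
Qed.

Definition loc t q : C := (chart_at t).2 q - (chart_at t).2 t.

Lemma loc_tt t : loc t t = 0. Proof. exact: subrr. Qed.

Lemma near_loc t q (P : C -> Prop) (r : R) : (chart_at t).1 q -> 0 < r ->
  (forall z, nm (z - loc t q) < r -> P z) -> \forall q' \near q, P (loc t q').
Proof.
move=> tq r0 rP.
have /(_ _) cq := rs_chart_continuous (chart_at_atlas t) (mem_set tq).
have : nbhs ((chart_at t).2 q) [set z | P (z - (chart_at t).2 t)].
  apply/nbhs_nmP; exists r => // z zr; apply: rP.
  by rewrite /loc opprB addrA subrK.
by move/cq.
Qed.

Lemma loc_open t q (W : set B) : (chart_at t).1 q -> nbhs q W ->
  exists2 r : R, 0 < r & forall z, nm (z - loc t q) < r ->
    exists2 q', W q' /\ (chart_at t).1 q' & loc t q' = z.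
Proof.
move=> tq; rewrite nbhsE => -[N [No Nq] NW].
have Uo := rs_chart_open (chart_at_atlas t).
have := rs_chart_open_map (chart_at_atlas t) (openI No Uo) (@subIsetr _ _ _).
rewrite openE => /(_ ((chart_at t).2 q))/(_ _)/wrap[|].
  by exists q.
rewrite /interior => /nbhs_nmP[r r0 rP]; exists r => // z.
have -> : z - loc t q = z + (chart_at t).2 t - (chart_at t).2 q.
  by rewrite /loc opprB addrA.
by move=> /rP[q' [Nq' tq'] E]; exists q'; [split => //; exact: NW|rewrite /loc E addrK].
Qed.

Lemma loc_inj t q : (chart_at t).1 q -> q != t -> loc t q != 0.
Proof.
move=> tq; apply: contraNneq => /eqP; rewrite subr_eq0 => /eqP E.
by apply/eqP/(rs_chart_inj (chart_at_atlas t)) => //; apply/mem_set => //; exact: chart_at_mem.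
Qed.

Lemma not_isolated q (W : set B) : nbhs q W -> exists2 q', W q' & q' != q.
Proof.
move=> /(loc_open (chart_at_mem q))[r r0 rP].
have r20 : 0 < r / 2 by rewrite divr_gt0.
have [|q' [Wq' _] E] := rP (r / 2)%:C%C.
  by rewrite loc_tt subr0 nm_real gtr0_norm//; lra.
exists q' => //; apply/eqP => qq; move: E; rewrite qq loc_tt => /(congr1 (@nm R)).
by rewrite nm0 nm_real gtr0_norm//; lra.
Qed.

Lemma near_not_in (S : set B) t : finite_set S -> \forall q \near t, q != t -> ~ S q.
Proof.
move=> Sf; have cl : closed (S `\ t).
  have /accessible_finite_set_closed : accessible_space B.
    by apply: hausdorff_accessible; exact: rs_hausdorff.
  by apply; exact: finite_setD.
have : nbhs t (~` (S `\ t)).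
  by apply: open_nbhs_nbhs; split; [exact: closed_openC|move=> []/= _].
by apply: filterS => q Hq qt Sq; apply: Hq; split => // /eqP; exact/negP.
Qed.

Lemma cdiff_comp (f g : C -> C) z d d' : cdiff g z d -> cdiff f (g z) d' ->
  cdiff (fun w => f (g w)) z (d' * d).
Proof.
move=> gd fd e e0.
have D0 : 0 < nm d + nm d' + 2 by rewrite !ltr_wpDl ?nm_ge0// addr_ge0 ?nm_ge0.
pose e' := Num.min 1 (e / (nm d + nm d' + 2)).
have e'0 : 0 < e' by rewrite lt_min ltr01 divr_gt0.
have [s s0 sP] := fd e' e'0; have [r1 r10 r1P] := gd e' e'0.
have [r2 r20 r2P] := cdiff_cont gd s0.
exists (Num.min r1 r2) => [|w]; first by rewrite lt_min r10.
rewrite lt_min => /andP[/r1P w1 /r2P/sP w2].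
have -> : f (g w) - f (g z) - d' * d * (w - z) =
  (f (g w) - f (g z) - d' * (g w - g z)) + d' * (g w - g z - d * (w - z)) by ring.
apply: le_trans (nmD _ _) _; rewrite nmM.
have gwz : nm (g w - g z) <= (nm d + 1) * nm (w - z).
  rewrite -(subrK (d * (w - z)) (g w - g z)).
  apply: le_trans (nmD _ _) _; rewrite nmM mulrDl mul1r addrC lerD2l.
  apply: le_trans w1 _; rewrite ler_piMl ?nm_ge0//.
  by rewrite /e' ge_min lexx.
have : e' * (nm d + nm d' + 2) <= e.
  by rewrite -ler_pdivlMr// /e' ge_min lexx orbT.
have n0 := nm_ge0 (w - z); have n1 := nm_ge0 d'; have n2 := nm_ge0 d.
move=> He; apply: le_trans (_ : e' * ((nm d + 1) * nm (w - z)) + nm d' * (e' * nm (w - z)) <= _).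
  apply: lerD; first by apply: le_trans w2 _; rewrite ler_wpM2l// ltW.
  by rewrite ler_wpM2l.
have -> : e' * ((nm d + 1) * nm (w - z)) + nm d' * (e' * nm (w - z)) =
  e' * (nm d + nm d' + 1) * nm (w - z) by ring.
rewrite ler_wpM2r//; apply: le_trans He; rewrite ler_wpM2l ?(ltW e'0)//; lra.
Qed.

Lemma holomorphic_nearP (g : C -> C) w : holomorphic_near g w ->
  exists2 r : R, 0 < r & forall z, nm (z - w) < r -> derivable g z 1.
Proof. by move=> /nbhs_nmP. Qed.

(** [holomorphic_at] speaks of some chart; composing with a transition map moves to the one
    coordinate [loc t]. *)
Lemma holomorphic_loc (f : B -> C) t : holomorphic_at f t ->
  exists g, exists2 r : R, 0 < r & (forall z, nm z < r -> derivable g z 1) /\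
    \forall q \near t, f q = g (loc t q).
Proof.
move=> [c ca [ct [g [/holomorphic_nearP[r r0 gr] gE]]]].
have [T [/holomorphic_nearP[s s0 Ts] TE]] :=
  rs_transition (chart_at_atlas t) ca (chart_at_mem t) ct.
have Tt : T ((chart_at t).2 t) = c.2 t by rewrite (nbhs_singleton TE).
have tt : nm ((chart_at t).2 t - (chart_at t).2 t) < s by rewrite subrr nm0.
have [a a0 aP] := cdiff_cont (derivable_cdiff (Ts _ tt)) r0.
exists (fun z => g (T ((chart_at t).2 t + z))), (Num.min s a).
  by rewrite lt_min s0.
split=> [z|].
  rewrite lt_min => /andP[zs za]; apply/cdiffP.
  have /Ts/derivable_cdiff Tz : nm ((chart_at t).2 t + z - (chart_at t).2 t) < s.
    by rewrite addrC addKr.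
  have /gr/derivable_cdiff gz : nm (T ((chart_at t).2 t + z) - c.2 t) < r.
    by rewrite -Tt; apply: aP; rewrite addrC addKr.
  by eexists; exact: (cdiff_comp (cdiff_shift Tz) gz).
apply: filterS2 gE TE => q -> ->.
by rewrite /loc addrC subrK.
Qed.

End LocalCoordinates.

(** * Maximum principle on a compact connected surface *)

Section GlobalPotentials.
Variables (R : realType) (B : riemannSurface R).
Local Notation C := (Cx R).
Implicit Types (p q t : B) (z w : C) (r e : R).
Hypothesis B_compact : compact [set: B].
Hypothesis B_connected : connected [set: B].

Lemma derivative_derivable (g : C -> C) r : (forall z, nm z < r -> derivable g z 1) ->
  forall z, nm z < r -> derivable (fun w => 'D_1 g w) z 1.
Proof.
move=> gr z zr; apply/cdiffP; apply: (@derivative_cdiff _ g z (r - nm z)).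
  by rewrite subr_gt0.
move=> w wz; apply: gr; have := nmD (w - z) z; rewrite subrK; lra.
Qed.

Lemma lpot_continuous0 (u : C -> R) (F : C -> C) r e : 0 < r -> 0 < e ->
  (forall z, nm z < r -> derivable F z 1) ->
  (forall z, nm z < r -> lpot u (F z) z) ->
  exists2 d, 0 < d & forall z, nm z < d -> `|u z - u 0| < e.
Proof.
move=> r0 e0 Fr uF; have n0 : nm (0 : C) < r by rewrite nm0.
have [s s0 sP] := cdiff_cont (derivable_cdiff (Fr 0 n0)) ltr01.
have M0 : 0 < nm (F 0) + 1 by rewrite ltr_wpDl ?nm_ge0.
exists (Num.min (Num.min r s) (e / (nm (F 0) + 1))).
  by rewrite !lt_min r0 s0 divr_gt0.
move=> z; rewrite !lt_min ltr_pdivlMr// => /andP[/andP[zr zs] ze].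
have tz (t : R) : 0 <= t <= 1 -> nm (0 + t%:C%C * z) <= nm z.
  move=> /andP[t0 t1]; rewrite add0r nmM nm_real ger0_norm//.
  by rewrite ler_piMl ?nm_ge0.
have uFt (t : R) : 0 <= t <= 1 -> lpot u (F (0 + t%:C%C * z)) (0 + t%:C%C * z).
  by move=> /tz tzz; apply: uF; exact: le_lt_trans zr.
have [t /andP[t0 t1]] := lpot_mvt uFt; rewrite add0r => ->.
apply: le_lt_trans (nm_Re _) _; rewrite nmM; apply: le_lt_trans ze.
rewrite mulrC ler_wpM2l ?nm_ge0//.
have /tz tzz : 0 <= t <= 1 by rewrite !ltW.
have := sP (0 + t%:C%C * z); rewrite subr0 => /(_ (le_lt_trans tzz zs)).
rewrite add0r => H; rewrite -(subrK (F 0) (F _)).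
by apply: le_trans (nmD _ _) _; lra.
Qed.

(** Harmonicity at [t]. Every point has its own gradient in its own coordinate, so no differential
    form has to be glued. *)
Definition local_potential (W : B -> R) t := exists u F r,
  [/\ 0 < r, forall z, nm z < r -> derivable F z 1,
      forall z, nm z < r -> lpot u (F z) z &
      \forall q \near t, W q = u (loc t q)].

Lemma near_loc0 t (P : C -> Prop) r : 0 < r -> (forall z, nm z < r -> P z) ->
  \forall q \near t, P (loc t q).
Proof.
move=> r0 rP; apply: (near_loc (chart_at_mem t) r0) => z.
by rewrite loc_tt subr0; exact: rP.
Qed.

(** By compactness the maximum is attained; the set where it is attained is closed by continuity and
    open by [local_max]. *)
Lemma local_potential_const (W : B -> R) :
  (forall t, local_potential W t) -> forall p q, W p = W q.
Proof.
move=> HW p q.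
have Wc : continuous W.
  move=> t; have [u [F [r [r0 Fr uF WE]]]] := HW t.
  apply/cvgrPdist_lt => e e0; have [d d0 dP] := lpot_continuous0 r0 e0 Fr uF.
  have Wt : W t = u 0 by rewrite (nbhs_singleton WE) loc_tt.
  apply: filterS2 WE (near_loc0 t d0 dP) => s -> H.
  by rewrite Wt distrC.
have [m _ mP] : exists2 m, m \in [set: B] & forall t, t \in [set: B] -> W t <= W m.
  by apply: compact_EVT_max => //; [exists p|exact: continuous_subspaceT].
have Wm : forall t, W t = W m.
  apply: (clopen_total B_connected); first by exists m.
    move=> t Wt; have [u [F [r [r0 Fr uF WE]]]] := HW t.
    have Wt0 : W t = u 0 by rewrite (nbhs_singleton WE) loc_tt.
    have [s s0 sP] := loc_open (chart_at_mem t) WE.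
    have rs0 : 0 < Num.min r s by rewrite lt_min r0.
    have [||v|v0 v00 v0P] := @local_max _ u F 0 (Num.min r s) rs0.
    - by move=> z; rewrite subr0 lt_min => /andP[zr _]; exact: Fr.
    - by move=> z; rewrite subr0 lt_min => /andP[zr _]; exact: uF.
    - rewrite subr0 lt_min => /andP[_ vs].
      have [|q' [Wq' _] <-] := sP v; first by rewrite loc_tt subr0.
      by rewrite -Wq' -Wt0 Wt mP// in_setT.
    have v0P' z : nm z < v0 -> u z = u 0.
      by move=> zv; apply: v0P; rewrite subr0.
    by apply: filterS2 WE (near_loc0 t v00 v0P') => s' -> ->; rewrite -Wt0.
  move=> t Wt; have /cvgrPdist_lt /(_ `|W t - W m|) := Wc t.
  rewrite normr_gt0 subr_eq0 => /(_ (introN eqP Wt)).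
  by apply: filterS => s H Ws; move: H; rewrite Ws ltxx.
by rewrite !Wm.
Qed.

Lemma holomorphic_const (f : B -> C) :
  (forall t, exists g, exists2 r, 0 < r & (forall z, nm z < r -> derivable g z 1) /\
     \forall q \near t, f q = g (loc t q)) -> forall p q, f p = f q.
Proof.
move=> Hf p q.
have Re_c : complex.Re (f p) = complex.Re (f q).
  apply: (@local_potential_const (fun t => complex.Re (f t))) => t.
  have [g [r r0 [gr fg]]] := Hf t.
  exists (fun z => complex.Re (g z)), (fun z => 'D_1 g z), r.
  split; [exact: r0|exact: derivative_derivable| |].
  - by move=> z /gr/derivable_cdiff; exact: lpot_Re.
  - by apply: filterS fg => s ->.
have Im_c : complex.Im (f p) = complex.Im (f q).
  apply: (@local_potential_const (fun t => complex.Im (f t))) => t.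
  have [g [r r0 [gr fg]]] := Hf t.
  exists (fun z => complex.Im (g z)), (fun z => - ('i%C * 'D_1 g z)), r.
  split; [exact: r0| | |].
  - move=> z zr; have gz := derivative_derivable gr zr.
    have H := dM (d_cst ('i%C : C) z) gz.
    have -> : (fun z => - ('i%C * 'D_1 g z)) = (fun z : C => 0 - ('i%C * 'D_1 g z) : C).
      by apply/funext => w; rewrite sub0r.
    exact: (dB (d_cst 0 z) H).
  - by move=> z /gr/derivable_cdiff; exact: lpot_Im.
  - by apply: filterS fg => s ->.
by move: Re_c Im_c; case: (f p) (f q) => a b [c d] /= -> ->.
Qed.

End GlobalPotentials.

(** * Local forms and orders of S-units *)

Section SUnits.
Variables (R : realType) (B : riemannSurface R) (S : set B).
Local Notation C := (Cx R).
Implicit Types (p q t : B) (z w : C) (r e : R) (x y : B -> P1 R).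
Hypothesis S_finite : finite_set S.

(** The value at [t] is recorded apart because [0 ^ n] is 0 also for negative [n] and would not
    express a pole. *)
Record local_form x t (n : int) (h : C -> C) r : Prop := LocalForm {
  lf_gt0 : 0 < r;
  lf_derivable : forall z, nm z < r -> derivable h z 1;
  lf_neq0 : forall z, nm z < r -> h z != 0;
  lf_near : \forall q \near t, q != t -> x q = Some (loc t q ^ n * h (loc t q));
  lf_at : x t = if n == 0 then Some (h 0) else if 0 < n then Some 0 else None
}.

Lemma Sunits_neq0 x q : Sunits S x -> ~ S q -> exists2 z, x q = Some z & z != 0.
Proof.
move=> [_ _ xS] Sq; case E: (x q) => [z|]; last by case: Sq; apply: xS; right.
exists z => //; apply/eqP => z0; apply: Sq; apply: xS; left.
by rewrite E z0.
Qed.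

(** Since [S] is finite, a unit has neither zeros nor poles in a punctured neighbourhood of [t];
    this excludes the vanishing alternative of [factorization]. *)
Lemma local_formP x t : Sunits S x -> exists n h r, local_form x t n h r.
Proof.
move=> xS; have [[_ /(_ t)[f ft fx]] _ _] := xS.
have [g [r r0 [gr fg]]] := holomorphic_loc ft.
have nS := near_not_in t S_finite.
have gr0 z : nm (z - 0) < r -> derivable g z 1 by rewrite subr0; exact: gr.
have f_neq0 : \forall q \near t, q != t -> f q != 0.
  case: fx => fx; apply: filterS2 fx nS => q xf nSq /nSq/(Sunits_neq0 xS)[z].
    by rewrite xf => -[->].
  move: xf => /[swap] -> /=; case: eqP => // /eqP z0 [<-] _.
  by rewrite invr_eq0.
have [[s s0 g0]|[n [h [hr h0 gE]]]] := factorization r0 gr0.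
  have g00 z : nm z < s -> g z = 0 by move=> zs; apply: g0; rewrite subr0.
  have [q [[fq0 fgq] gq] qt] :=
    not_isolated (filterI (filterI f_neq0 fg) (near_loc0 t s0 g00)).
  by move: (fq0 qt); rewrite fgq gq eqxx.
have n0 : nm (0 - 0 : C) < r by rewrite subrr nm0.
have h00 : 0 < nm (h 0) by rewrite nm_gt0.
have [s s0 sP] := cdiff_cont (derivable_cdiff (hr 0 n0)) h00.
have hs z : nm z < Num.min r s -> h z != 0.
  rewrite lt_min => /andP[_ zs]; apply/eqP => hz.
  by have := sP z; rewrite subr0 => /(_ zs); rewrite hz sub0r nmN ltxx.
have hd z : nm z < Num.min r s -> derivable h z 1.
  by rewrite lt_min => /andP[zr _]; apply: hr; rewrite subr0.
have rs0 : 0 < Num.min r s by rewrite lt_min r0.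
have fE : \forall q \near t, f q = loc t q ^+ n * h (loc t q).
  by apply: filterS fg => q ->; rewrite gE subr0.
have ft0 : f t = if n == 0%N then h 0 else 0.
  rewrite (nbhs_singleton fE) loc_tt; case: (n) => [|m]; first by rewrite mul1r.
  by rewrite expr0n mul0r.
case: fx => fx.
  exists n%:Z, h, (Num.min r s); split => //.
    by apply: filterS2 fx fE => q -> ->.
  by rewrite (nbhs_singleton fx) ft0; case: (n).
(* Here 1 / x is the function that was factored, so exponent and cofactor are inverted. *)
exists (- n%:Z), (fun z => (h z)^-1), (Num.min r s); split.
- exact: rs0.
- by move=> z zr; exact: (dV (hd z zr) (hs z zr)).
- by move=> z /hs; rewrite invr_eq0.
- apply: filterS3 fx fE nS => q + fEq nSq qt.
  have [z -> z0] := Sunits_neq0 xS (nSq qt); rewrite /= (negbTE z0) => -[].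
  by rewrite fEq => zE; rewrite -[z]invrK zE invfM exprnN.
have := nbhs_singleton fx; rewrite ft0.
case: (n) => [|m] /=; case: (x t) => [z|] //=; first 1 last.
- by case=> /esym/eqP; rewrite (negbTE h0).
- case: eqP => // /eqP z0 [] /eqP; by rewrite invr_eq0 (negbTE z0).
by case: eqP => // /eqP z0 [<-]; rewrite invrK.
Qed.

(** For an S-unit a local form exists, so the default 0 is not reached. *)
Definition ord x t : int := xget 0 [set n | exists h r, local_form x t n h r].

Lemma ordP x t : Sunits S x -> exists h r, local_form x t (ord x t) h r.
Proof. by move=> /(local_formP t)[n nP]; rewrite /ord; case: xgetP => [m _ //|/(_ n)]. Qed.

Lemma ord_notin x t : Sunits S x -> ~ S t -> ord x t = 0.
Proof.
move=> xS tS; have [h [r H]] := ordP t xS; have := lf_at H.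
have [z -> z0] := Sunits_neq0 xS tS; case: eqP => // _.
by case: ifP => // _ [] /eqP; rewrite (negbTE z0).
Qed.

(** The default at a pole, and the convention for the logarithm of 0 in [log_at], concern only
    points of [S] when [x] is an S-unit. *)
Definition val_at x q : C := odflt 0 (x q).

Definition log_at x q : R := ln (nm (val_at x q)).

End SUnits.

(** * Relations between orders and logarithms *)

Section LogRelations.
Variables (R : realType) (B : riemannSurface R) (S : set B).
Local Notation C := (Cx R).
Implicit Types (p q t : B) (z w : C) (r e : R) (x y : B -> P1 R).
Hypothesis B_compact : compact [set: B].
Hypothesis B_connected : connected [set: B].
Hypothesis S_finite : finite_set S.

Lemma local_form_ge x t n (h : C -> C) r s : 0 < s -> s <= r ->
  local_form x t n h r -> local_form x t n h s.
Proof.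
move=> s0 sr [_ hd h0 xn xt]; split; [exact: s0| | |exact: xn|exact: xt].
  by move=> z zs; apply: hd; exact: lt_le_trans sr.
by move=> z zs; apply: h0; exact: lt_le_trans sr.
Qed.

Lemma finite_min k (r : 'I_k -> R) : (forall i, 0 < r i) ->
  exists2 s, 0 < s & forall i, s <= r i.
Proof.
elim: k r => [|k IH] r r0; first by exists 1 => // -[].
have [s s0 sP] := IH (fun i => r (lift ord0 i)) (fun i => r0 _).
exists (Num.min (r ord0) s) => [|i]; first by rewrite lt_min r0.
have [j ->|->] := unliftP ord0 i; last by rewrite ge_min lexx.
by rewrite ge_min sP orbT.
Qed.

Lemma common_form k (x : 'I_k -> B -> P1 R) t : (forall j, Sunits S (x j)) ->
  exists h r, 0 < r /\ forall j, local_form (x j) t (ord (x j) t) (h j) r.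
Proof.
move=> xS; have /choice[h hP] : forall j, exists h, exists r,
    local_form (x j) t (ord (x j) t) h r by move=> j; exact: (ordP S_finite t (xS j)).
have /choice[r rP] := hP.
have [s s0 sr] := finite_min (fun j => lf_gt0 (rP j)).
by exists h, s; split => // j; exact: local_form_ge (rP j).
Qed.

Lemma d_Xn n z : derivable (fun w : C => w ^+ n : C) z 1.
Proof.
elim: n => [|n IH].
  have -> : (fun w : C => w ^+ 0 : C) = fun=> 1 by apply/funext => w; rewrite expr0.
  exact: d_cst.
have -> : (fun w : C => w ^+ n.+1 : C) = fun w : C => w * w ^+ n : C.
  by apply/funext => w; rewrite exprS.
exact: (dM (d_id z) IH).
Qed.

Lemma dsum k (f : 'I_k -> C -> C) z : (forall j, derivable (f j) z 1) ->
  derivable (fun w : C => \sum_(j < k) f j w : C) z 1.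
Proof.
elim: k f => [|k IH] f fz.
  have -> : (fun w : C => \sum_(j < 0) f j w : C) = fun=> 0.
    by apply/funext => w; rewrite big_ord0.
  exact: d_cst.
have -> : (fun w : C => \sum_(j < k.+1) f j w : C) =
    fun w : C => f ord0 w + \sum_(j < k) f (lift ord0 j) w : C.
  by apply/funext => w; rewrite big_ord_recl.
exact: (dD (fz ord0) (IH _ (fun j => fz _))).
Qed.

Section LogPotential.
Variables (k : nat) (a : 'I_k -> R) (h : 'I_k -> C -> C) (r : R).
Hypothesis h_derivable : forall j z, nm z < r -> derivable (h j) z 1.
Hypothesis h_neq0 : forall j z, nm z < r -> h j z != 0.

(** The part of the sum of the a_j log |x_j| that stays finite at the centre of the coordinate, once
    the multiples of log |z| are split off; [dlog_sum] is its gradient. *)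
Definition log_sum (z : C) : R := \sum_(j < k) a j * ln (nm (h j z)).

Definition dlog_sum (z : C) : C := \sum_(j < k) (a j)%:C%C * ('D_1 (h j) z / h j z).

Lemma dlog_sum_derivable z : nm z < r -> derivable dlog_sum z 1.
Proof.
move=> zr; apply: dsum => j.
have h1 := derivative_derivable (@h_derivable j) zr.
have h2 := dV (@h_derivable j z zr) (@h_neq0 j z zr).
exact: (dM (d_cst ((a j)%:C%C : C) z) (dM h1 h2)).
Qed.

Lemma log_sum_lpot z : nm z < r -> lpot log_sum (dlog_sum z) z.
Proof.
move=> zr; apply: lpot_sum => j; apply: lpotZ; apply: lpot_ln; last exact: h_neq0.
exact: (derivable_cdiff (@h_derivable j z zr)).
Qed.

End LogPotential.

Lemma ln_nmXz z (n : int) : z != 0 -> ln (nm (z ^ n)) = n%:~R * ln (nm z).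
Proof.
move=> z0; have zp : 0 < nm z by rewrite nm_gt0.
case: n => n; first by rewrite -exprnP nmX lnXn// -mulr_natl pmulrn.
rewrite NegzE -exprnN nmV nmX lnV ?posrE ?exprn_gt0// lnXn//.
by rewrite mulrNz mulNr -mulr_natl pmulrn.
Qed.

Lemma log_at_near k (a : 'I_k -> R) (x : 'I_k -> B -> P1 R) t h r :
  (forall j, local_form (x j) t (ord (x j) t) (h j) r) ->
  \forall q \near t, q != t -> \sum_(j < k) a j * log_at (x j) q =
    (\sum_(j < k) a j * (ord (x j) t)%:~R) * ln (nm (loc t q)) +
    log_sum a h (loc t q).
Proof.
move=> hP.
have H : \forall q \near t, forall j, q != t ->
    x j q = Some (loc t q ^ ord (x j) t * h j (loc t q)).
  by apply: filter_forall => j; exact: lf_near (hP j).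
have Hh : \forall q \near t, forall j, h j (loc t q) != 0.
  apply: filter_forall => j.
  exact: (near_loc0 t (lf_gt0 (hP j)) (lf_neq0 (hP j))).
apply: filterS3 H Hh (chart_at_nbhs t) => q xq hq tq qt.
have z0 := loc_inj tq qt.
rewrite mulr_suml /log_sum -big_split /=; apply: eq_bigr => j _.
rewrite /log_at /val_at (xq j qt) /= nmM lnM ?posrE ?nm_gt0 ?hq//; last first.
  exact: expfz_neq0.
by rewrite ln_nmXz// mulrDr mulrA.
Qed.

Lemma val_at_notin x q h r : Sunits S x -> ~ S q ->
  local_form x q (ord x q) h r -> x q = Some (h 0).
Proof. by move=> xS qS H; rewrite (lf_at H) (ord_notin S_finite xS qS)// eqxx. Qed.

(** The relation cancels the multiples of log |z| at every point. The value of the regular part at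
    the centre, [W] in the proof, then continues the sum harmonically across [S]. *)
Lemma log_relation_const k (a : 'I_k -> R) (x : 'I_k -> B -> P1 R) :
  (forall j, Sunits S (x j)) ->
  (forall t, \sum_(j < k) a j * (ord (x j) t)%:~R = 0) ->
  exists c, forall q, ~ S q -> \sum_(j < k) a j * log_at (x j) q = c.
Proof.
move=> xS ax.
have /choice[h hP] : forall t, exists h : 'I_k -> C -> C, exists r, 0 < r /\
    forall j, local_form (x j) t (ord (x j) t) (h j) r.
  by move=> t; exact: common_form.
pose W t := log_sum a (h t) 0.
have WE q : ~ S q -> \sum_(j < k) a j * log_at (x j) q = W q.
  move=> qS; have [r [_ H]] := hP q; apply: eq_bigr => j _.
  by rewrite /log_at /val_at (val_at_notin (xS j) qS (H j)).
have [[p pS]|nS] := pselect (exists p, ~ S p); last first.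
  by exists 0 => q qS; case: nS; exists q.
exists (W p) => q qS; rewrite WE//.
apply: (local_potential_const B_compact B_connected) => t.
have [r [r0 H]] := hP t.
exists (log_sum a (h t)), (dlog_sum a (h t)), r; split; first exact: r0.
- by move=> z zr; apply: (@dlog_sum_derivable _ a _ r _ _ z zr) => j w wr;
    [exact: (lf_derivable (H j) wr)|exact: (lf_neq0 (H j) wr)].
- by move=> z zr; apply: (@log_sum_lpot _ a _ r _ _ z zr) => j w wr;
    [exact: (lf_derivable (H j) wr)|exact: (lf_neq0 (H j) wr)].
apply: filterS2 (log_at_near a H) (near_not_in t S_finite) => s + sS.
have [->|st] := eqVneq s t; first by rewrite loc_tt.
by move=> /(_ isT); rewrite ax mul0r add0r (WE _ (sS st)).
Qed.

(* 0 ^+ n t * k t 0 is the value at t of a quotient of S-units that is loc ^ n k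
   near t. *)
Lemma quotient_const (n : B -> nat) (k : B -> C -> C) :
  (forall t, exists r, [/\ 0 < r, forall z, nm z < r -> derivable (k t) z 1 &
    \forall q \near t, q != t -> n q = 0%N /\
      k q 0 = loc t q ^+ n t * k t (loc t q)]) ->
  forall p q, 0 ^+ n p * k p 0 = 0 ^+ n q * k q 0.
Proof.
move=> H p q; pose f t : C := 0 ^+ n t * k t 0.
apply: (holomorphic_const B_compact B_connected (f := f)) => t.
have [r [r0 kr kE]] := H t.
exists (fun z : C => z ^+ n t * k t z : C), r; first exact: r0.
split; first by move=> z zr; exact: (dM (@d_Xn (n t) z) (kr z zr)).
apply: filterS kE => s; have [->|st /(_ isT)[n0 kE]] := eqVneq s t.
  by rewrite /f loc_tt.
by rewrite /f n0 expr0 mul1r.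
Qed.

Lemma near_forms x t (h : B -> C -> C) : Sunits S x ->
  (forall t, exists r, local_form x t (ord x t) (h t) r) ->
  \forall q \near t, q != t -> [/\ ord x q = 0, loc t q != 0, x q = Some (h q 0) &
    h q 0 = loc t q ^ ord x t * h t (loc t q)].
Proof.
move=> xS hP; have [r H] := hP t.
apply: filterS3 (lf_near H) (near_not_in t S_finite) (chart_at_nbhs t).
move=> q xq nS tq qt; have qS := nS qt; have [s Hs] := hP q.
have E := val_at_notin xS qS Hs.
split; [exact: (ord_notin S_finite)|exact: loc_inj|exact: E|].
by move: E; rewrite xq// => -[].
Qed.

(** The quotient x / y is represented by the cofactor values h t 0 / g t 0: equal powers of the
    coordinate cancel, so it is holomorphic on all of [B], hence constant. *)
Lemma ord_inj x y : Sunits S x -> Sunits S y -> (forall t, ord x t = ord y t) ->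
  [set: B] !=set0 -> exists2 c : C, c != 0 & x = scale c y.
Proof.
move=> xS yS xy [p _].
have /choice[h hP] : forall t, exists h, exists r, local_form x t (ord x t) h r.
  by move=> t; exact: (ordP S_finite t xS).
have /choice[g gP] : forall t, exists h, exists r, local_form y t (ord y t) h r.
  by move=> t; exact: (ordP S_finite t yS).
have K := @quotient_const (fun=> 0%N) (fun t z => h t z / g t z).
have {}K t : h t 0 / g t 0 = h p 0 / g p 0.
  suff /K /(_ t p) : forall t, exists r, [/\ 0 < r,
      forall z, nm z < r -> derivable (fun z => h t z / g t z) z 1 &
      \forall q \near t, q != t -> 0%N = 0%N /\
        h q 0 / g q 0 = loc t q ^+ 0 * (h t (loc t q) / g t (loc t q))].
    by rewrite !expr0 !mul1r.
  move=> {}t; have [r H] := hP t; have [s G] := gP t.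
  exists (Num.min r s); split; first by rewrite lt_min (lf_gt0 H) (lf_gt0 G).
    move=> z; rewrite lt_min => /andP[zr zs].
    exact: (dM (lf_derivable H zr) (dV (lf_derivable G zs) (lf_neq0 G zs))).
  apply: filterS2 (near_forms t xS hP) (near_forms t yS gP) => q Hq Gq qt.
  have [_ z0 _ ->] := Hq qt; have [_ _ _ ->] := Gq qt; split => //.
  by rewrite xy invfM mulrACA divff ?expfz_neq0// mul1r expr0 mul1r.
have h0 t : h t 0 != 0.
  by have [r H] := hP t; apply: (lf_neq0 H); rewrite nm0 (lf_gt0 H).
have g0 t : g t 0 != 0.
  by have [r H] := gP t; apply: (lf_neq0 H); rewrite nm0 (lf_gt0 H).
exists (h p 0 / g p 0); first by rewrite mulf_neq0// invr_eq0.
apply/funext => t; have [r H] := hP t; have [s G] := gP t.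
rewrite /scale (lf_at H) (lf_at G) -xy; case: ifP => _ /=.
  by rewrite -(K t) divfK.
by case: ifP => //= _; rewrite mulr0.
Qed.

(** Either x or 1 / x is holomorphic on [B], hence constant. A nonzero order at [t0] would make the
    constant 0, against its value at a neighbouring point. *)
Lemma ord_signed_eq0 x : Sunits S x ->
  (forall t, 0 <= ord x t) \/ (forall t, ord x t <= 0) -> forall t, ord x t = 0.
Proof.
move=> xS x_signed t0.
have /choice[h hP] : forall t, exists h, exists r, local_form x t (ord x t) h r.
  by move=> t; exact: (ordP S_finite t xS).
have h0 t : h t 0 != 0.
  by have [r H] := hP t; apply: (lf_neq0 H); rewrite nm0 (lf_gt0 H).
have [k [k0 kP]] : exists k : B -> C -> C, (forall t, k t 0 != 0) /\
  forall t, exists r, [/\ 0 < r, forall z, nm z < r -> derivable (k t) z 1 &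
    \forall q \near t, q != t -> `|ord x q|%N = 0%N /\
      k q 0 = loc t q ^+ `|ord x t|%N * k t (loc t q)].
  case: x_signed => x0.
    exists h; split => // t; have [r H] := hP t; exists r; split.
    - exact: (lf_gt0 H).
    - by move=> z zr; exact: (lf_derivable H zr).
    - apply: filterS (near_forms t xS hP) => q Hq /Hq[-> _ _ ->]; split => //.
      by rewrite -[in LHS](gez0_abs (x0 t)).
  exists (fun t z => (h t z)^-1); split => [t|t]; first by rewrite invr_eq0.
  have [r H] := hP t; exists r; split.
  - exact: (lf_gt0 H).
  - by move=> z zr; exact: (dV (lf_derivable H zr) (lf_neq0 H zr)).
  - apply: filterS (near_forms t xS hP) => q Hq /Hq[-> _ _ ->]; split => //.
    have -> : ord x t = - `|ord x t|%N%:Z by rewrite lez0_abs// opprK.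
    by rewrite abszN absz_nat -exprnN invfM invrK.
have K := quotient_const kP.
have [r [_ _ /not_isolated[q Hq qt]]] := kP t0.
have [ordq _] := Hq qt; have := K t0 q; rewrite ordq expr0 mul1r.
have [/eqP|n0] := eqVneq `|ord x t0|%N 0%N; first by rewrite absz_eq0 => /eqP.
by rewrite expr0n (negbTE n0) mul0r => /esym/eqP; rewrite (negbTE (k0 q)).
Qed.

End LogRelations.

(** * Linear independence of logarithms of S-units *)

Section LogIndependence.
Variables (R : realType) (B : riemannSurface R) (S : set B).
Local Notation C := (Cx R).
Implicit Types (p q t : B) (z w : C) (r e : R).
Hypothesis B_connected : connected [set: B].
Hypothesis S_finite : finite_set S.

Variables (k : nat) (a : 'I_k -> R) (x : 'I_k -> B -> P1 R) (c : R).
Hypothesis x_units : forall j, Sunits S (x j).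

Let W q := \sum_(j < k) a j * log_at (x j) q - c.
Let K t := \sum_(j < k) a j * (ord (x j) t)%:~R.
Let Z q := \forall q' \near q, ~ S q' -> W q' = 0.

(* In the coordinate z at t, the gradient of W is G z / z with
   G z = K t + z \sum_j a_j h_j' / h_j, and the zeros of G are isolated. *)
Lemma log_relation_local t :
  (K t = 0 /\ exists d, \forall q \near t, ~ S q -> W q = d) \/
  (\forall q \near t, q != t -> ~ Z q).
Proof.
have [h [r [r0 H]]] := common_form S_finite t x_units.
have hd j z : nm z < r -> derivable (h j) z 1 by move=> zr; exact: (lf_derivable (H j) zr).
have hn j z : nm z < r -> h j z != 0 by move=> zr; exact: (lf_neq0 (H j) zr).
have WE := log_at_near a H; rewrite -/(K t) in WE.
have Fd z : nm z < r -> derivable (dlog_sum a h) z 1.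
  by move=> zr; exact: (@dlog_sum_derivable _ _ a h r hd hn z zr).
have Fp z : nm z < r -> lpot (log_sum a h) (dlog_sum a h z) z.
  by move=> zr; exact: (@log_sum_lpot _ _ a h r hd hn z zr).
pose F := dlog_sum a h; pose u := log_sum a h.
pose G (z : C) : C := (K t)%:C%C + z * F z.
have Gd z : nm (z - 0) < r -> derivable G z 1.
  rewrite subr0 => zr.
  exact: (dD (d_cst ((K t)%:C%C : C) z) (dM (d_id z) (Fd z zr))).
have [[s s0 G0]|[n [g [gd g0 GE]]]] := factorization r0 Gd.
  left; have {}G0 z : nm z < s -> G z = 0 by move=> zs; apply: G0; rewrite subr0.
  have K0 : K t = 0.
    have := G0 0; rewrite nm0 => /(_ s0); rewrite /G mul0r addr0 => /(congr1 (@nm R)).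
    by rewrite nm0 nm_real => /eqP; rewrite normr_eq0 => /eqP.
  have F0' z : z != 0 -> nm z < s -> F z = 0.
    move=> z0 /G0; rewrite /G K0 rmorph0 add0r => /eqP.
    by rewrite mulf_eq0 (negbTE z0) => /eqP.
  (* The equation z F(z) = 0 says nothing at z = 0; there the continuity of [F] decides. *)
  have F00 : F 0 = 0.
    apply/eqP; apply: contrapT => /negP F00.
    have n0 : nm (0 : C) < r by rewrite nm0.
    have f0 : 0 < nm (F 0) by rewrite nm_gt0.
    have [d d0 dP] := cdiff_cont (derivable_cdiff (Fd 0 n0)) f0.
    have m0 : 0 < Num.min s d / 2 by rewrite divr_gt0// lt_min s0.
    pose z : C := (Num.min s d / 2)%:C%C.
    have zE : nm z = Num.min s d / 2 by rewrite nm_real gtr0_norm.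
    have zm : nm z < Num.min s d by rewrite zE; lra.
    move: zm; rewrite lt_min => /andP[zs zd].
    have := dP z; rewrite subr0 => /(_ zd).
    rewrite -/F F0' ?sub0r ?nmN ?ltxx// -nm_gt0 zE//.
  split=> //; exists (u 0 - c).
  have rs0 : 0 < Num.min r s by rewrite lt_min r0.
  have uc z : nm z < Num.min r s -> u z = u 0.
    move=> zrs; apply: (@lpot0_const _ u 0 (Num.min r s)); last by rewrite subr0.
    move=> w; rewrite subr0 lt_min => /andP[wr ws].
    have [w0|w0] := eqVneq w 0; first by have := Fp w wr; rewrite -/F w0 F00.
    by rewrite -(F0' w w0 ws); exact: Fp.
  apply: filterS2 WE (near_loc0 t rs0 uc) => q + uq qS.
  have [qt _|qt] := eqVneq q t; last first.
    by move=> /(_ isT) Wq; rewrite /W Wq K0 mul0r add0r -/u; move: uq => /= ->.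
  rewrite /W /u /log_sum qt; congr (_ - _); apply: eq_bigr => j _.
  by rewrite /log_at /val_at (val_at_notin S_finite (x_units j) _ (H j)) -?qt.
right.
have n0 : nm (0 - 0 : C) < r by rewrite subrr nm0.
have g00 : 0 < nm (g 0) by rewrite nm_gt0.
have [s s0 sP] := cdiff_cont (derivable_cdiff (gd 0 n0)) g00.
have GN z : nm z < s -> z != 0 -> G z != 0.
  move=> zs z0; rewrite GE subr0 mulf_neq0 ?expf_neq0//; apply/eqP => gz.
  by have := sP z; rewrite subr0 => /(_ zs); rewrite gz sub0r nmN ltxx.
have rs0 : 0 < Num.min r s by rewrite lt_min r0.
have nrs := near_loc0 (P := fun z => nm z < Num.min r s) t rs0 (fun _ zs => zs).
have ctS : \forall q \near t, (chart_at t).1 q /\ (q != t -> ~ S q).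
  exact: (filterI (chart_at_nbhs t) (near_not_in t S_finite)).
apply: filterS3 (nbhs_interior WE) ctS nrs => q WEq [tq qS] /= qrs qt Zq.
have qrs' : nm (loc t q) < r /\ nm (loc t q) < s by move: qrs; rewrite lt_min => /andP[].
case: qrs' => qr qs.
have z0 := loc_inj tq qt.
(* [U] is [W] in the coordinate at [t]. Its gradient at [loc t q] is G(z) / z, and would be 0 if [W]
   vanished near [q]. *)
pose U (z : C) : R := K t * ln (nm z) + u z - c.
have U0 : \forall q' \near q, U (loc t q') = 0.
  have nt := near_not_in q (finite_set1 t).
  have nS := near_not_in q S_finite.
  apply: filterS (filterI (filterI WEq Zq) (filterI nt nS)) => q' [[Wq' Zq'] [q't q'S]].
  have q'nt : q' != t.
    have [->//|] := eqVneq q' q; move=> /q't H'; apply/eqP => E; exact: H'.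
  have q'nS : ~ S q'.
    have [->|/q'S//] := eqVneq q' q; exact: qS.
  by rewrite -(Zq' q'nS) /W Wq'.
have [d d0 dP] := loc_open tq U0.
have Up : lpot U ((K t)%:C%C * (1 / loc t q) + F (loc t q) + 0) (loc t q).
  apply: lpotD; last exact: lpot_cst.
  apply: lpotD; last exact: Fp.
  apply: lpotZ; apply: (@lpot_ln _ (fun w => w)) => //; exact: cdiff_id.
have E := lpot_eq0 d0 Up.
have /E E0 : forall w, nm (w - loc t q) < d -> U w = U (loc t q).
  move=> w /dP[q' [Uq' _] <-]; rewrite Uq'.
  by rewrite (nbhs_singleton U0).
have /negP[] := GN _ qs z0; apply/eqP.
transitivity (loc t q * ((K t)%:C%C * (1 / loc t q) + F (loc t q) + 0)).
  rewrite /G addr0 mulrDr; congr (_ + _).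
  by rewrite mulrCA mul1r divff// mulr1.
by rewrite E0 mulr0.
Qed.

(** If [Z] fails at [t], then either it fails all around [t], or the sum is a constant near [t],
    which must be nonzero; so [Z] is closed as well as open. Once [Z] holds everywhere, only the
    alternative with [K t = 0] remains. *)
Lemma log_independent : (exists p, Z p) -> forall t, K t = 0.
Proof.
move=> Zp.
have ZT : forall t, Z t.
  apply: (clopen_total B_connected) => // t.
    by move=> /nbhs_interior.
  move=> nZ; have [[_ [d dP]]|H] := log_relation_local t; last first.
    by apply: filterS H => q H; have [->//|/H] := eqVneq q t.
  apply: filterS (nbhs_interior dP) => q dq Zq; apply: nZ.
  have [q' [[dq' Zq'] q'S] q'q] :=
    not_isolated (filterI (filterI dq Zq) (near_not_in q S_finite)).
  have d0 : d = 0 by rewrite -(dq' (q'S q'q)) Zq'//; exact: q'S.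
  by rewrite /Z; apply: filterS dP => s; rewrite d0.
move=> t; have [[//]|H] := log_relation_local t.
by have [q Hq /Hq/(_ (ZT q))] := not_isolated H.
Qed.

End LogIndependence.

(** The rows are taken from [P] itself and not just from its span, so that they can be realized by
    units and by points. *)
Lemma row_basis (F : fieldType) n (P : set 'rV[F]_n) : exists k (A : 'M[F]_(k, n)),
  [/\ forall i, P (row i A), row_free A & forall v, P v -> (v <= A)%MS].
Proof.
pose Q k := `[< exists2 A : 'M[F]_(k, n), forall i, P (row i A) & row_free A >].
have Q0 : exists k, Q k.
  exists 0%N; apply/asboolP; exists 0; first by case.
  by rewrite /row_free mxrank0.
have Qn k : Q k -> (k <= n)%N.
  by move=> /asboolP[A _ /eqP <-]; exact: rank_leq_col.
case: (ex_maxnP Q0 Qn) => k /asboolP[A AP Af] kmax.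
exists k, A; split => // v Pv; apply: contrapT => /negP vA.
have : Q (1 + k)%N.
  apply/asboolP; exists (col_mx v A) => [i|].
    case: (split_ordP i) => j ->.
      by rewrite rowKu (_ : row j v = v)//; apply/rowP => l; rewrite mxE ord1.
    by rewrite rowKd.
  have rE : \rank (col_mx v A) = \rank (v + A)%MS by rewrite addsmxE.
  have [le_r eq_r] := mxrank_leqif_sup (addsmxSr v A).
  rewrite /row_free eqn_leq rank_leq_row rE add1n.
  rewrite (eqP Af) in le_r eq_r; rewrite ltn_neqAle le_r andbT eq_r.
  by rewrite addsmx_sub negb_and vA.
by move=> /kmax; rewrite add1n ltnn.
Qed.

(** * Bounding the order vectors *)

Section Finiteness.
Variables (R : realType) (B : riemannSurface R) (S : set B).
Local Notation C := (Cx R).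
Implicit Types (p q t : B) (z w : C) (x y : B -> P1 R).
Hypothesis B_compact : compact [set: B].
Hypothesis B_connected : connected [set: B].
Hypothesis B_nonempty : [set: B] !=set0.
Hypothesis S_finite : finite_set S.

Lemma log_at_bounded (B0 : set B) (e : R) x t : 0 < e -> Sunits_bounded S B0 e x ->
  B0 t -> `|log_at x t| <= - ln e.
Proof.
move=> e0 [_ /(_ t)] H /H[z xz []]; rewrite !normE !ltcR nmV => ez ez'.
have z0 : 0 < nm z by apply: lt_trans ez.
rewrite /log_at /val_at xz /= ler_norml opprK; apply/andP; split.
  by rewrite ler_ln ?posrE// ltW.
by rewrite -lerN2 opprK -lnV ?posrE// ler_ln ?posrE ?invr_gt0// ltW.
Qed.

Lemma ord_bounded (B0 : set B) (e : R) : 0 < e -> (forall t, B0 t -> ~ S t) ->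
  (exists2 p, B0 p & nbhs p B0) ->
  exists N : nat, forall x, Sunits_bounded S B0 e x -> forall t, `|ord x t| <= N%:Z.
Proof.
move=> e0 B0S [p0 B0p0 nB0].
have /finite_fsetP[X SX] := S_finite.
pose l : seq B := enum_fset X; pose n := size l.
pose s (i : 'I_n) : B := tnth (in_tuple l) i.
have sP t : S t -> exists i, t = s i.
  by rewrite SX /= => /(@tnthP _ _ (in_tuple l)).
pose vec x : 'rV[R]_n := \row_i (ord x (s i))%:~R.
have [k [A [AP Af AS]]] := row_basis [set vec x | x in Sunits S].
have /choice[x xP] : forall j, exists x, Sunits S x /\ vec x = row j A.
  by move=> j; have [x xS xA] := AP j; exists x.
have xS j : Sunits S (x j) by have [] := xP j.
have xA j i : (ord (x j) (s i))%:~R = A j i.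
  by have [_ /rowP/(_ i)] := xP j; rewrite !mxE.
(* Differences with the base point [p0] eliminate the additive constant in each relation between
   logarithms. *)
pose lam t : 'rV[R]_k := \row_j (log_at (x j) t - log_at (x j) p0).
have [m [L [LP _ LS]]] := row_basis [set lam t | t in B0].
have /choice[t tP] : forall i, exists t, B0 t /\ lam t = row i L.
  by move=> i; have [t tB0 tL] := LP i; exists t.
(* A vector orthogonal to all [lam t] makes a combination of logarithms constant on [B0], hence is a
   relation between the order vectors, and these are independent. *)
have Lf : row_full L.
  rewrite -col_leq_rank -mxrank_tr; have : row_free L^T; last by move/eqP->.
  apply: inj_row_free => b bL.
  have bL0 q : B0 q -> lam q *m b^T = 0.
    move=> qB0; have /submxP[D ->] : (lam q <= L)%MS by apply: LS; exists q.
    by rewrite -mulmxA -[L]trmxK -trmx_mul bL trmx0 mulmx0.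
  have bord : forall t, \sum_(j < k) b ord0 j * (ord (x j) t)%:~R = 0.
    apply: (log_independent (c := \sum_(j < k) b ord0 j * log_at (x j) p0)
      B_connected S_finite xS).
    exists p0; apply: filterS nB0 => q qB0 _.
    have /rowP/(_ ord0) := bL0 q qB0; rewrite !mxE => E; rewrite -[RHS]E.
    rewrite -sumrB; apply: eq_bigr => j _; rewrite !mxE; ring.
  have bA : b *m A = 0.
    apply/rowP => i; rewrite !mxE -[RHS](bord (s i)).
    by apply: eq_bigr => j _; rewrite xA.
  by have /row_freeP[A' AA'] := Af; rewrite -[b]mulmx1 -AA' mulmxA bA mul0mx.
have /row_fullP[Y YL] := Lf.
pose M := - ln e.
(* For vec y = a A, the entries of L a^T are differences of two logarithms of |y|, hence at most M +
   M in absolute value; Y is a left inverse of L and returns the coefficients a. None of this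
   depends on y. *)
pose K i := \sum_(j < k) (\sum_(a < m) `|Y j a| * (M + M)) * `|A j i|.
pose N := (\sum_i (Num.truncn (K i)).+1)%N.
exists N => y yB q; have yS : Sunits S y by case: yB.
have [/sP[i ->]|qS] := pselect (S q); last by rewrite (ord_notin S_finite yS qS).
have /submxP[a yA] : (vec y <= A)%MS by apply: AS; exists y.
have yE i' : (ord y (s i'))%:~R = \sum_(j < k) a ord0 j * A j i'.
  by have /rowP/(_ i') := yA; rewrite !mxE.
(* The relation vec y - a A = 0 is fed to [log_relation_const], with [y] at index 0 and coefficient
   1. *)
pose x' (j : 'I_k.+1) := if unlift ord0 j is Some j' then x j' else y.
pose a' (j : 'I_k.+1) : R := if unlift ord0 j is Some j' then - a ord0 j' else 1.
have sumE (f : (B -> P1 R) -> R) : \sum_(j < k.+1) a' j * f (x' j) =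
    f y - \sum_(j < k) a ord0 j * f (x j).
  rewrite big_ord_recl /a' /x' unlift_none mul1r; congr (_ + _).
  by rewrite -sumrN; apply: eq_bigr => j _; rewrite liftK mulNr.
have [||c cP] := @log_relation_const R B S B_compact B_connected S_finite _ a' x'.
- by move=> j; rewrite /x'; case: (unlift ord0 j).
- move=> t'; rewrite (sumE (fun y => (ord y t')%:~R)).
  have [/sP[i' ->]|tS] := pselect (S t').
    by rewrite yE; apply/eqP; rewrite subr_eq0; apply/eqP; apply: eq_bigr => j _; rewrite xA.
  rewrite (ord_notin S_finite yS tS) big1 ?subr0// => j _.
  by rewrite (ord_notin S_finite (xS j) tS) mulr0.
have cP' q' : B0 q' -> log_at y q' - \sum_(j < k) a ord0 j * log_at (x j) q' = c.
  by move=> /B0S/cP; rewrite (sumE (fun y => log_at y q')).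
have La i' : (L *m a^T) i' ord0 = log_at y (t i') - log_at y p0.
  have [tB0 tL] := tP i'; have := cP' _ tB0; rewrite -(cP' _ B0p0) => E.
  have -> : log_at y (t i') - log_at y p0 = \sum_(j < k) a ord0 j * log_at (x j) (t i')
     - \sum_(j < k) a ord0 j * log_at (x j) p0 by lra.
  rewrite !mxE -sumrB; apply: eq_bigr => j _.
  have /rowP/(_ j) := tL; rewrite !mxE => <-; ring.
have LaM i' : `|(L *m a^T) i' ord0| <= M + M.
  rewrite La (le_trans (ler_normB _ _))//; apply: lerD; apply: log_at_bounded yB _ => //.
  by have [] := tP i'.
have aM j : `|a ord0 j| <= \sum_(i' < m) `|Y j i'| * (M + M).
  have -> : a ord0 j = (Y *m (L *m a^T)) j ord0 by rewrite mulmxA YL mul1mx mxE.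
  rewrite mxE (le_trans (ler_norm_sum _ _ _))//; apply: ler_sum => i' _.
  by rewrite normrM ler_wpM2l.
have : `|(ord y (s i))%:~R : R| <= K i.
  rewrite yE (le_trans (ler_norm_sum _ _ _))//; apply: ler_sum => j _.
  by rewrite normrM ler_wpM2r.
rewrite -intr_norm => /le_lt_trans/(_ (truncnS_gt _)) H.
rewrite -(ler_int R); apply: le_trans (ltW H) _; rewrite pmulrn ler_nat.
by rewrite /N (bigD1 i)//= leq_addr.
Qed.

End Finiteness.

(** * Finiteness modulo constants *)

Section DiscTopology.
Variable R : realType.
Local Notation C := (Cx R).

Lemma compact_unit_disc : compact [set z : C | `|z| <= 1].
Proof.
have disc_nm (z : C) : (`|z| <= 1) = (nm z <= 1) by rewrite normE -lecR.
pose f (p : R * R) : C := (p.1 +i* p.2)%C.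
have fc : continuous f.
  move=> p W /nbhs_nmP[r r0 rW]; apply/nbhs_ballP; exists (r / 2); first by rewrite /= divr_gt0.
  move=> q [/= q1 q2]; apply: rW; apply: le_lt_trans (nm_le_ReIm _) _.
  by move: q1 q2; rewrite /ball /= (distrC p.1) (distrC p.2); lra.
apply: (@subclosed_compact _ _ (f @` (`[-1, 1] `*` `[-1, 1]))).
- rewrite -openC openE => z /= /negP; rewrite disc_nm.
  rewrite -ltNge => z1; apply/nbhs_nmP; exists (nm z - 1); first by rewrite subr_gt0.
  move=> w wz /=; rewrite disc_nm => w1.
  by have := nmB w (w - z); rewrite opprB addrC subrK; lra.
- apply: continuous_compact; first exact: continuous_subspaceT.
  by apply: compact_setX; exact: segment_compact.
move=> z /=; rewrite disc_nm => z1.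
exists (complex.Re z, complex.Im z); last by case: z {z1}.
split; rewrite /= in_itv /= -ler_norml; apply: le_trans z1; [exact: nm_Re|exact: nm_Im].
Qed.

Variable B : riemannSurface R.

Lemma closed_disc_closed (D : set B) p : closed_disc D p -> closed D.
Proof.
move=> [psi [psic _ <- _ _]]; apply: compact_closed; first exact: rs_hausdorff.
by apply: continuous_compact => //; exact: compact_unit_disc.
Qed.

Lemma closed_disc_center (D : set B) p : closed_disc D p -> D p.
Proof. by move=> [psi [_ _ <- <- _]]; exists 0 => //=; rewrite normr0 ler01. Qed.

Lemma discs_centered_at_closed (S U : set B) : finite_set S ->
  discs_centered_at S U -> closed U.
Proof.
move=> Sf [D [DS _ ->]]; apply: closed_bigcup => // s /DS; exact: closed_disc_closed.
Qed.

Lemma finite_disjoint_discs_closed (V : set B) : finite_disjoint_discs V -> closed V.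
Proof.
move=> [n [D [DP _ ->]]]; apply: closed_bigcup; first exact: finite_finset.
move=> i _; by have [p] := DP i; exact: closed_disc_closed.
Qed.

(* If the discs covered B, each of them would be clopen. *)
Lemma disc_centers_unique (S U V : set B) : connected [set: B] -> finite_set S ->
  discs_centered_at S U -> finite_disjoint_discs V -> V `<=` ~` U ->
  ~ (~` U `\` V !=set0) -> forall s t, S s -> S t -> s = t.
Proof.
move=> Bc Sf [D [DS Dtriv UE]] /finite_disjoint_discs_closed Vc VU UV s t Ss St.
have cover q : U q \/ V q.
  have [|nU] := pselect (U q); first by left.
  by right; apply: contrapT => nV; apply: UV; exists q.
suff DsT : forall q, D s q.
  apply: Dtriv => //; exists t; split; first exact: DsT.
  exact: closed_disc_center (DS _ St).
have Rc : closed (\bigcup_(s' in S `\ s) D s').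
  apply: closed_bigcup; first exact: finite_setD.
  by move=> s' [/DS + _]; exact: closed_disc_closed.
apply: (clopen_total Bc); first by exists s; exact: closed_disc_center (DS _ Ss).
  move=> q Dsq; have Oq : open_nbhs q (~` (V `|` \bigcup_(s' in S `\ s) D s')).
    split; first by rewrite openC; exact: closedU.
    move=> [/VU|[s' [Ss' s's] Ds'q]].
      by apply; rewrite UE; exists s.
    by apply: s's; apply: Dtriv => //; exists q.
  apply: filterS (open_nbhs_nbhs Oq) => q' /not_orP[nV nD].
  have [|//] := cover q'; rewrite UE => -[s' Ss' Ds'q'].
  have [<-//|s's] := eqVneq s' s.
  by case: nD; exists s' => //; split => //; exact/eqP.
move=> q nDq; apply: open_nbhs_nbhs; split => //.
by rewrite openC; exact: closed_disc_closed (DS _ Ss).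
Qed.

End DiscTopology.

Section ModConstants.
Variables (R : realType) (B : riemannSurface R).
Local Notation C := (Cx R).
Implicit Types (x y : B -> P1 R).

Lemma scale_scale (c d : C) x : scale c (scale d x) = scale (c * d) x.
Proof. by apply/funext => t; rewrite /scale; case: (x t) => //= z; rewrite mulrA. Qed.

Lemma class_eq (c : C) x y : c != 0 -> x = scale c y ->
  [set u | exists2 d : C, d != 0 & u = scale d x] =
  [set u | exists2 d : C, d != 0 & u = scale d y].
Proof.
move=> c0 ->; apply/seteqP; split=> u [d d0 ->].
  by exists (d * c); rewrite ?mulf_neq0// scale_scale.
exists (d / c); first by rewrite mulf_neq0// invr_eq0.
by rewrite scale_scale divfK.
Qed.

Lemma finite_mod_constants (T : finType) (J : set (B -> P1 R))
    (code : (B -> P1 R) -> T) :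
  (forall x y, J x -> J y -> code x = code y -> exists2 c : C, c != 0 & x = scale c y) ->
  finite_set (mod_constants J).
Proof.
move=> Jcode; pose repr v : B -> P1 R := xget (fun=> None) [set x | J x /\ code x = v].
pose g v := [set y | exists2 c : C, c != 0 & y = scale c (repr v)].
apply: (@sub_finite_set _ _ (g @` [set: T])).
  move=> _ [x Jx <-]; exists (code x) => //; rewrite /g /repr.
  case: xgetP => [y _ [Jy xy]|/(_ x)]; last by case.
  have [c c0 yx] := Jcode _ _ Jy Jx xy; exact: class_eq c0 yx.
by apply: finite_image; exact: finite_finset.
Qed.

End ModConstants.

Theorem theorem2 (R : realType) (B : riemannSurface R)
    (B_nonempty : [set: B] !=set0)
    (B_compact : compact [set: B]) (B_connected : connected [set: B])
    (S : set B) (S_finite : finite_set S)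
    (U V : set B) (U_discs : discs_centered_at S U)
    (V_discs : finite_disjoint_discs V) (V_sub : V `<=` ~` U)
    (B0 : set B) (B0E : B0 = ~` U `\` V)
    (Zt : spaceWithFunctions R) (Zt_smooth : smooth_variety Zt)
    (Z : set (analytic Zt)) (Z_compact : compact Z)
    (D : subscheme (product (ruled B) Zt)) (D_family : divisor_family D)
    (D_flat : flat_along (@drop_P1 R B Zt) D)
    (D_fibers : forall z : Zt, ~ (fiber D z `<=`
       constant_section (Some 0) `|` constant_section None))
    (e : R) (e_gt0 : 0 < e) :
  (forall r : nat, finite_set (mod_constants (large_union S B0 Z D r e))) /\
  exists2 m : R, 0 < m & forall r : nat,
    (#|` fset_set (mod_constants (large_union S B0 Z D r e))|)%:R
      <= m * (r.+1)%:R ^+ (2 * pi1_rank R B0).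
Proof.
have sub r : mod_constants (large_union S B0 Z D r e) `<=`
    mod_constants (Sunits_bounded S B0 e).
  by move=> _ [x [z _ [T _ [xS _]]] <-]; exists x.
suff fin : finite_set (mod_constants (Sunits_bounded S B0 e)).
  have finr r : finite_set (mod_constants (large_union S B0 Z D r e)).
    exact: sub_finite_set (sub r) fin.
  (* The added 1 keeps [m] positive when there is no class at all. *)
  split=> //; exists (#|` fset_set (mod_constants (Sunits_bounded S B0 e))|%:R + 1).
    by rewrite ltr_wpDl.
  move=> r; apply: (@le_trans _ _ (#|` fset_set (mod_constants (Sunits_bounded S B0 e))|%:R)).
    by rewrite ler_nat; apply: fsubset_leq_card; rewrite -fset_set_sub.
  apply: (@le_trans _ _ (#|` fset_set (mod_constants (Sunits_bounded S B0 e))|%:R + 1)).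
    by rewrite lerDl.
  by rewrite ler_peMr ?addr_ge0// exprn_ege1// ler1n.
have B0S t : B0 t -> ~ S t.
  rewrite B0E => -[nUt _] St; apply: nUt; have [Delta [DS _ ->]] := U_discs.
  by exists t => //; exact: closed_disc_center (DS _ St).
have [N NP] : exists N : nat, forall x, Sunits_bounded S B0 e x ->
    forall t, `|ord x t| <= N%:Z.
  have [[p B0p]|B0_0] := pselect (B0 !=set0).
    apply: (ord_bounded B_compact B_connected S_finite e_gt0 B0S); exists p => //.
    apply: open_nbhs_nbhs; split=> //; rewrite B0E setDE.
    apply: openI; rewrite openC; last exact: finite_disjoint_discs_closed V_discs.
    exact: discs_centered_at_closed U_discs.
  (* No logarithm is bounded when [B0] is empty. Instead [S] has at most one point, so the orders of
     a unit have constant sign and all vanish. *)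
  exists 0%N => x [xS _] t; suff -> : ord x t = 0 by rewrite normr0.
  apply: (ord_signed_eq0 B_compact B_connected S_finite xS).
  rewrite B0E in B0_0.
  have S1 := disc_centers_unique B_connected S_finite U_discs V_discs V_sub B0_0.
  have [[s Ss]|S0] := pselect (S !=set0); last first.
    by left=> q; rewrite (ord_notin S_finite xS)// => Sq; apply: S0; exists q.
  have [os|os] := leP 0 (ord x s); [left|right] => q.
    have [/(S1 _ _ Ss) <-//|qS] := pselect (S q); by rewrite (ord_notin S_finite xS).
  have [/(S1 _ _ Ss) <-|qS] := pselect (S q); first exact: ltW.
  by rewrite (ord_notin S_finite xS).
have /finite_fsetP[X SX] := S_finite.
pose s (i : 'I_(size (enum_fset X))) : B := tnth (in_tuple (enum_fset X)) i.
have sP t : S t -> exists i, t = s i.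
  by rewrite SX /= => /(@tnthP _ _ (in_tuple (enum_fset X))).
(* Orders lie between -N and N; shifted by [N] they fit into ['I_(N + N).+1], where [inord] loses
   nothing. *)
pose code (x : B -> P1 R) :=
  [ffun i => inord (absz (ord x (s i) + N%:Z)) : 'I_(N + N).+1].
apply: (@finite_mod_constants _ _ _ _ code) => x y xB yB xy.
have xS : Sunits S x by case: xB.
have yS : Sunits S y by case: yB.
apply: (ord_inj B_compact B_connected S_finite xS yS) => // t.
have [/sP[i ->]|tS] := pselect (S t); last by rewrite !(ord_notin S_finite _ tS).
have /ffunP/(_ i) := xy; rewrite !ffunE => /(congr1 val).
have := NP x xB (s i); have := NP y yB (s i); rewrite !ler_norml.
move=> /andP[y1 y2] /andP[x1 x2]; rewrite /= !inordK; [lia|lia|lia].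
Qed.
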